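(* Consider a stencil computation with aperiodic boundary conditions on a $d$-dimensional spatial grid of $N$ cells, run for $T$ timesteps, where the stencil is linear and homogeneous (spatially and temporally uniform) with constant radius $\sigma=\Theta(1)$ and $d=\Theta(1)$. Let $b$ denote the number of grid cells whose values are defined by the boundary conditions. Then the algorithm $\textsc{StencilFFT-A}$ computes the grid data $a_T$ at the $T$th timestep from the initial data $a_0$ in $\Theta\big(bT\log(bT)\log T + N\log N\big)$ work and $\Theta\big(T\log b + \log N\log\log N\big)$ span.
   Context: A stencil computation on a $d$-dimensional grid of size $\ell_1\times\cdots\times\ell_d = N$ evolves initial data $a_0$ by $a_{t+1} = S a_t$, where the linear homogeneous stencil $S$ computes each cell's new value as a fixed linear combination (the same coefficients at every cell and every timestep) of the values at the previous timestep of the cells within distance $\sigma$ of it (the stencil radius). With aperiodic boundary conditions the grid does not wrap around: cells near the grid boundary, where the stencil cannot be applied, instead receive their values at each timestep from the boundary conditions (an arbitrary prescribed rule). The goal is to output $a_T$. $\textsc{StencilFFT-A}$ is the paper's algorithm for this problem: it computes the cells not influenced by the boundary (those at distance more than $\sigma T$ from the boundary) via fast Fourier transforms applied to the periodic version of the problem, and computes the boundary's region of influence by a recursive divide-and-conquer over time that halves the number of timesteps at each level. Complexity is measured in the work-span model: work is the total number of operations, and span is the length of the critical path under the binary-forking model, in which spawning $n$ threads costs $\Theta(\log n)$ span.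
   Formalization: The boundary recursion of StencilFFT-A stops at about log b·log min(T,b) timesteps and then steps directly on strips of width 2σ times that cutoff; halving down to O(1) timesteps would give span of order T log b log log b instead of T log b. *)

(* Defs.v *)
From HB Require Import structures.
From mathcomp Require Import all_boot all_order all_algebra.
From mathcomp Require Import reals exp.

Set Implicit Arguments.
Unset Strict Implicit.
Unset Printing Implicit Defensive.

Import Order.TTheory GRing.Theory Num.Theory.

Local Open Scope ring_scope.

Definition log2 (R : realType) (x : R) : R := ln x / ln 2%:R.

(** * Work-span cost model *)

(* A computation, recorded by its output, its number of unit operations and
   the length of its critical path.  Every scalar operation, comparison, table
   access, and evaluation of the boundary rule is a unit operation ([op]); the
   address arithmetic on the d coordinates of a cell, and the scalar
   bookkeeping with array extents and step counts, is included in it. *)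
Record cost (A : Type) := Cost {
  output : A;
  cost_work : nat;
  cost_span : nat }.

Definition ret (A : Type) (a : A) : cost A := Cost a 0 0.

Definition op (A : Type) (a : A) : cost A := Cost a 1 1.

Definition bind (A B : Type) (m : cost A) (f : A -> cost B) : cost B :=
  let n := f (output m) in
  Cost (output n) (cost_work m + cost_work n) (cost_span m + cost_span n).

Notation "'let*' x := m 'in' f" := (bind m (fun x => f))
  (at level 200, x name, m at level 100, f at level 200, right associativity).

Definition test (A : Type) (c : bool) (m1 m2 : cost A) : cost A :=
  let* c' := op c in if c' then m1 else m2.

Fixpoint seq_for (I A : Type) (s : seq I) (f : A -> I -> cost A) (a : A) :
    cost A :=
  if s is i :: s' then let* a' := f a i in seq_for s' f a' else ret a.

(* Binary fork. *)
Definition par (A B : Type) (m : cost A) (n : cost B) : cost (A * B) :=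
  Cost (output m, output n)
       (cost_work m + cost_work n).+1
       (maxn (cost_span m) (cost_span n)).+1.

(* Parallel loop over the index list [s]: its iterations are spawned by a
   balanced binary tree of forks, and each of them writes one entry of the
   resulting table.  Arrays are such tables; reading an entry that was never
   written yields [a0]. *)
Definition pfor (I : eqType) (A : Type) (a0 : A) (s : seq I)
    (f : I -> cost A) : cost (I -> A) :=
  Cost (fun i => if i \in s then output (f i) else a0)
       (\sum_(i <- s) (cost_work (f i)).+1)%N
       ((up_log 2 (size s)).+1 + \max_(i <- s) cost_span (f i))%N.

Definition rd (I A : Type) (a : I -> A) (i : I) : cost A := op (a i).

Section Scalars.

Variable C : numClosedFieldType.

Definition seq_sum (I : Type) (s : seq I) (f : I -> cost C) : cost C :=
  seq_for s (fun acc i => let* v := f i in op (acc + v)) 0.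

Fixpoint pow_rec (fuel : nat) (x : C) (n : nat) : cost C :=
  if fuel is fuel'.+1 then
    if n == 0%N then ret 1 else
    let* x2 := op (x * x) in
    let* y := pow_rec fuel' x2 n./2 in
    test (odd n) (op (x * y)) (ret y)
  else ret 1.

(* x ^+ n by repeated squaring *)
Definition pow (x : C) (n : nat) : cost C := pow_rec n x n.

(** * Fast Fourier transform *)

(* A primitive 2^k-th root of unity (for k > 0), by repeated square roots
   of -1; its inverse when [inv] is set. *)
Definition root2 (inv : bool) (k : nat) : cost C :=
  let* z := seq_for (iota 0 k.-1) (fun z _ => op (sqrtC z)) (-1) in
  test inv (op z^-1) (ret z).

(* The table of the powers of that root. *)
Definition roots2 (inv : bool) (k : nat) : cost (nat -> C) :=
  let* z := root2 inv k in pfor 0 (iota 0 (2 ^ k)) (fun j => pow z j).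

(* Cooley-Tukey on 2^k points, with the balanced splitting
   2^k = 2^k1 * 2^k2; [w] tabulates the powers of a 2^k-th root of unity:
   the result is  m |-> \sum_(j < 2^k) w (j * m) * u j. *)
Fixpoint fft_rec (fuel k : nat) (w u : nat -> C) : cost (nat -> C) :=
  if fuel is fuel'.+1 then
    if (k <= 1)%N then
      pfor 0 (iota 0 (2 ^ k)) (fun m =>
        seq_sum (iota 0 (2 ^ k)) (fun j =>
          let* x := rd u j in
          let* z := rd w (j * m)%N in
          op (z * x)))
    else
      let k1 := k./2 in
      let k2 := (k - k1)%N in
      let n1 := (2 ^ k1)%N in
      let n2 := (2 ^ k2)%N in
      let* A := pfor (fun _ => 0) (iota 0 n2) (fun j2 =>
        fft_rec fuel' k1 (fun j => w (n2 * j)%N)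
                         (fun j1 => u (n2 * j1 + j2)%N)) in
      let* B := pfor (fun _ => 0) (iota 0 n1) (fun m1 =>
        let* v := pfor 0 (iota 0 n2) (fun j2 =>
          let* x := rd (A j2) m1 in
          let* z := rd w (j2 * m1)%N in
          op (z * x)) in
        fft_rec fuel' k2 (fun j => w (n1 * j)%N) v) in
      pfor 0 (iota 0 (2 ^ k)) (fun m => rd (B (m %% n1)%N) (m %/ n1)%N)
  else pfor 0 (iota 0 1) (fun m => rd u m).

Definition fft (k : nat) (w u : nat -> C) : cost (nat -> C) := fft_rec k k w u.

(** * Cells of the grid *)

Variable d : nat.

Definition vec := {ffun 'I_d -> int}.

(* The cells x with 0 <= x i < n i for all i. *)
Definition box (n : 'I_d -> nat) : seq vec :=
  [seq [ffun i => (nat_of_ord (y i))%:Z] | y : {dffun forall i : 'I_d, 'I_(n i)}].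

Definition upd (x : vec) (i : 'I_d) (j : nat) : vec :=
  [ffun i' => if i' == i then j%:Z else x i'].

Definition pow2 (k : 'I_d -> nat) (i : 'I_d) : nat := (2 ^ k i)%N.

(* One-dimensional transforms of all the lines in direction i of an array of
   extents 2^(k i); a line is named by its cell of i-th coordinate 0. *)
Definition fft_dim (inv : bool) (k : 'I_d -> nat) (a : vec -> C) (i : 'I_d) :
    cost (vec -> C) :=
  let* w := roots2 inv (k i) in
  let* L := pfor (fun _ => 0)
    (box (fun j => if j == i then 1%N else pow2 k j))
    (fun x => fft (k i) w (fun j => a (upd x i j))) in
  pfor 0 (box (pow2 k)) (fun y => rd (L (upd y i 0)) `|y i|%N).

Definition fftn (inv : bool) (k : 'I_d -> nat) (a : vec -> C) :
    cost (vec -> C) :=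
  seq_for (enum 'I_d) (fft_dim inv k) a.

Variable sigma : nat.

(* Offsets in [-sigma, sigma]^d, shifted by sigma. *)
Definition offset := {ffun 'I_d -> 'I_(sigma.*2.+1)}.

Definition offv (o : offset) : vec :=
  [ffun i => (nat_of_ord (o i))%:Z - sigma%:Z].

(** * The stencil problem *)

(* [bc t x win] is the value that the boundary rule assigns to the boundary
   cell x at time t+1; besides t and x the rule may use the values at time t
   of the cells within distance sigma of x, [win o] being that of the cell
   x + offv o (0 if there is no such cell). *)
Record stencil_problem := StencilProblem {
  extent : 'I_d -> nat;
  coef : offset -> C;
  bc : nat -> vec -> {ffun offset -> C} -> C;
  init : vec -> C }.

Variable p : stencil_problem.

(* [inner 0] is the grid; [inner sigma] are the cells whose sigma-neighbourhood
   is inside the grid, to which the stencil applies; [inner (sigma * t)] are the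
   cells not influenced by the boundary during t steps. *)
Definition inner (m : nat) (x : vec) : bool :=
  [forall i, (m%:Z <= x i) && (x i < (extent p i)%:Z - m%:Z)].

Definition num_cells : nat := (\prod_(i < d) extent p i)%N.

Definition num_boundary_cells : nat :=
  count (fun x => ~~ inner sigma x) (box (extent p)).

Definition window (a : vec -> C) (x : vec) : {ffun offset -> C} :=
  [ffun o => if inner 0 (x + offv o) then a (x + offv o) else 0].

Definition step (t : nat) (a : vec -> C) (x : vec) : C :=
  if inner sigma x then \sum_(o : offset) coef p o * a (x + offv o)
  else bc p t x (window a x).

(* The grid data a_T (meaningful on the cells of the grid). *)
Fixpoint evolution (T : nat) : vec -> C :=
  if T is t.+1 then step t (evolution t) else init p.

(** * Periodic solver *)

(* h steps on the periodic grid of extents 2^(k i): with c the kernel of the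
   circular convolution, this is  F^-1 ((F c)^h * F a). *)
Definition stencilFFT_P (k : 'I_d -> nat) (h : nat) (a : vec -> C) :
    cost (vec -> C) :=
  let* c := pfor 0 (box (pow2 k)) (fun y =>
    seq_sum (enum offset) (fun o =>
      test [forall i, (- offv o i == y i %[mod (pow2 k i)%:Z])%Z]
        (rd (coef p) o) (ret 0))) in
  let* Fc := fftn false k c in
  let* Fa := fftn false k a in
  let* Fb := pfor 0 (box (pow2 k)) (fun y =>
    let* l := rd Fc y in
    let* lh := pow l h in
    let* v := rd Fa y in
    op (lh * v)) in
  let* b := fftn true k Fb in
  pfor 0 (box (pow2 k)) (fun y =>
    let* v := rd b y in op (v / (\prod_(i < d) pow2 k i)%:R)).

(** * Aperiodic solver *)

(* The face (i, false) is x i = 0 and the face (i, true) is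
   x i = extent p i - 1. *)
Definition face := ('I_d * bool)%type.

Definition dist (f : face) (x : vec) : int :=
  if f.2 then (extent p f.1)%:Z - 1 - x f.1 else x f.1.

Definition slab_extent (f : face) (w : nat) (j : 'I_d) : nat :=
  if j == f.1 then w else extent p j.

Definition slab_origin (f : face) (w : nat) : vec :=
  [ffun j => if (j == f.1) && f.2 then (extent p j)%:Z - w%:Z else 0].

(* The slab of width w along a face.  Slabs are not clipped: a slab wider than
   the grid has positions outside the grid, where all tables contain 0. *)
Definition slab (f : face) (w : nat) : seq vec :=
  [seq y + slab_origin f w | y <- box (slab_extent f w)].

(* The 2d slabs; the cells that lie in several slabs are stored (and computed)
   once in each. *)
Definition strip (w : nat) : seq vec :=
  flatten [seq slab f w | f <- enum {: face}].

Definition stepM (t : nat) (a : vec -> C) (x : vec) : cost C :=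
  test (inner sigma x)
    (seq_sum (enum offset) (fun o =>
      let* v := rd a (x + offv o) in
      let* s := rd (coef p) o in
      op (s * v)))
    (test (inner 0 x)
      (let* win := pfor 0 (enum offset) (fun o => rd a (x + offv o)) in
       op (bc p t x [ffun o => win o]))
      (ret 0)).

(* h direct steps on the strip of width w, from time t. *)
Definition direct (w t h : nat) (a : vec -> C) : cost (vec -> C) :=
  seq_for (iota t h) (fun a' t' => pfor 0 (strip w) (stepM t' a')) a.

(* h steps of the periodic solver on each slab of width w, zero-padded to
   power-of-two extents. *)
Definition free_slabs (w h : nat) (a : vec -> C) : cost (face -> vec -> C) :=
  pfor (fun _ => 0) (enum {: face}) (fun f =>
    let k j := up_log 2 (slab_extent f w j) in
    let* buf := pfor 0 (box (pow2 k)) (fun y => rd a (y + slab_origin f w)) in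
    stencilFFT_P k h buf).

(* On the strip of width w - sigma * h: take the cells not influenced by the
   boundary during h steps from the slabs, the others from [a]. *)
Definition merge (w h : nat) (ev : face -> vec -> C) (a : vec -> C) :
    cost (vec -> C) :=
  pfor 0 (strip (w - sigma * h)) (fun x =>
    test (inner (sigma * h) x)
      (if [pick f : face | dist f x < (w - sigma * h)%:Z] is Some f
       then rd (ev f) (x - slab_origin f w) else ret 0)
      (rd a x)).

(* From the data at time t on the strip of width 2 * sigma * T, compute the
   data at time t + T on the strip of width sigma * T.  Below the cut-off tau
   the steps are done directly, on a strip wide enough for tau steps. *)
Fixpoint recursive_boundary (fuel tau T t : nat) (a : vec -> C) :
    cost (vec -> C) :=
  if fuel is fuel'.+1 then
    test (T <= tau)%N
      (direct (2 * sigma * tau) t T a)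
      (let h1 := T./2 in
       let h2 := (T - h1)%N in
       let w1 := (2 * sigma * T)%N in
       let w2 := (w1 - sigma * h1)%N in
       let* r1 := par (free_slabs w1 h1 a)
                      (recursive_boundary fuel' tau h1 t a) in
       let* a1 := merge w1 h1 r1.1 r1.2 in
       let* r2 := par (free_slabs w2 h2 a1)
                      (recursive_boundary fuel' tau h2 (t + h1) a1) in
       merge w2 h2 r2.1 r2.2)
  else ret a.

(* This cut-off makes the cost of the direct steps and that of the transforms
   of short slabs comparable: with a constant cut-off the span would acquire a
   factor log log b. *)
Definition cutoff (T : nat) : nat :=
  ((trunc_log 2 num_boundary_cells).+1
   * (trunc_log 2 (minn T num_boundary_cells)).+1)%N.

Definition stencilFFT_A (T : nat) : cost (vec -> C) :=
  let k i := up_log 2 (extent p i) in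
  let* a := pfor 0 (box (extent p)) (fun x => rd (init p) x) in
  let* r := par (stencilFFT_P k T a)
                (recursive_boundary T (cutoff T) T 0 a) in
  pfor 0 (box (extent p)) (fun x =>
    test (inner (sigma * T) x) (rd r.1 x) (rd r.2 x)).

End Scalars.

(* Main.v *)
Require Import Defs.
From mathcomp Require Import all_boot all_order all_algebra.
From mathcomp Require Import reals exp.
From mathcomp Require Import zify ring lra.

(* Correctness.  The one-dimensional transforms along distinct axes commute,
   and each is inverted by the transform at the inverse root of unity.  A
   periodic step is a linear combination of translations, so the transform
   diagonalizes it; its symbol is the transform of the kernel, which is the
   image of the unit impulse under one step.  Hence the periodic solver
   computes the iterates of the periodic step, and these agree with the
   aperiodic evolution on cells whose domain of dependence neither meets the
   boundary nor wraps around.  The recursion keeps the invariant that the table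
   is the true grid data on a strip along the boundary and 0 outside the grid.

   Costs.  Let A be the total area of the 2d faces.  Then b <= sigma A and
   A <= 2 d b, so a strip of width proportional to T has Theta(b T) cells.  The
   calls of the recursion with more steps than the cut-off tau spend
   O(b T log (b T)) work per level, and the direct steps spend Theta(b T tau)
   in total.  For the lower bound, if T <= b then the direct steps suffice, as
   tau is about log b log T; if b < T then the transforms of the calls with at
   least sqrt T steps do.  The span overhead of a call with T > tau >= log b
   steps is O(log b (log T)^2), and it sums to O(T log b) because
   19 T - (l^2 + 6 l + 11), where l is the integer part of log T, is a potential
   that absorbs (l + 1)^2 in each halving. *)

Set Implicit Arguments.
Unset Strict Implicit.
Unset Printing Implicit Defensive.

Import Order.TTheory GRing.Theory Num.Theory.

(** * Work and span of the combinators *)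

Local Open Scope nat_scope.

Notation lg := (trunc_log 2).
Notation ulg := (up_log 2).

(** Work and span are bounded by one predicate, so that a single rule per combinator serves both
    measures. *)
Definition ub (A : Type) (m : cost A) (w s : nat) :=
  cost_work m <= w /\ cost_span m <= s.

Definition lb (A : Type) (m : cost A) (w s : nat) :=
  w <= cost_work m /\ s <= cost_span m.

Lemma output_bind A B (m : cost A) (f : A -> cost B) :
  output (bind m f) = output (f (output m)).
Proof. by []. Qed.

Lemma output_op A (a : A) : output (op a) = a.
Proof. by []. Qed.

Lemma output_rd I A (a : I -> A) i : output (rd a i) = a i.
Proof. by []. Qed.

Lemma output_par A B (m : cost A) (n : cost B) :
  output (par m n) = (output m, output n).
Proof. by []. Qed.

Lemma output_pfor (I : eqType) A (a0 : A) (r : seq I) f i :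
  output (pfor a0 r f) i = if i \in r then output (f i) else a0.
Proof. by []. Qed.

Lemma output_test A c (m1 m2 : cost A) :
  output (test c m1 m2) = if c then output m1 else output m2.
Proof. by case: c. Qed.

Lemma ub_le A (m : cost A) w s w' s' :
  ub m w s -> w <= w' -> s <= s' -> ub m w' s'.
Proof. by move=> [mw ms] ww ss; split; [exact: leq_trans ww | exact: leq_trans ss]. Qed.

Lemma lb_le A (m : cost A) w s w' s' :
  lb m w s -> w' <= w -> s' <= s -> lb m w' s'.
Proof. by move=> [mw ms] ww ss; split; [exact: leq_trans mw | exact: leq_trans ms]. Qed.

Lemma lb0 A (m : cost A) : lb m 0 0.
Proof. by []. Qed.

Lemma ub_op A (a : A) : ub (op a) 1 1.
Proof. by []. Qed.

(** The bound on the continuation is asked for every argument, not only for the actual output of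
    [m]; this keeps the cost analysis independent of what is computed. *)
Lemma ub_bind A B (m : cost A) (f : A -> cost B) w s w' s' :
  ub m w s -> (forall a, ub (f a) w' s') -> ub (bind m f) (w + w') (s + s').
Proof.
move=> [mw ms] fb; case: (fb (output m)) => fw fs.
by split; apply: leq_add.
Qed.

Lemma lb_bind A B (m : cost A) (f : A -> cost B) w s w' s' :
  lb m w s -> (forall a, lb (f a) w' s') -> lb (bind m f) (w + w') (s + s').
Proof.
move=> [mw ms] fb; case: (fb (output m)) => fw fs.
by split; apply: leq_add.
Qed.

Lemma ub_test A c (m1 m2 : cost A) w s :
  ub m1 w s -> ub m2 w s -> ub (test c m1 m2) w.+1 s.+1.
Proof. by move=> m1b m2b; rewrite -add1n -[s.+1]add1n; apply: ub_bind => // -[]. Qed.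

Lemma ub_testT A (m1 m2 : cost A) w s :
  ub m1 w s -> ub (test true m1 m2) w.+1 s.+1.
Proof. by []. Qed.

Lemma ub_testF A (m1 m2 : cost A) w s :
  ub m2 w s -> ub (test false m1 m2) w.+1 s.+1.
Proof. by []. Qed.

Lemma lb_testT A (m1 m2 : cost A) w s : lb m1 w s -> lb (test true m1 m2) w s.
Proof. by case=> mw ms; split; apply: leqW. Qed.

Lemma lb_testF A (m1 m2 : cost A) w s : lb m2 w s -> lb (test false m1 m2) w s.
Proof. by case=> mw ms; split; apply: leqW. Qed.

Lemma ub_par A B (m : cost A) (n : cost B) w s w' s' :
  ub m w s -> ub n w' s' -> ub (par m n) (w + w').+1 (maxn s s').+1.
Proof.
move=> [mw ms] [nw ns]; split; rewrite ltnS; first exact: leq_add.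
by rewrite geq_max !leq_max ms ns orbT.
Qed.

Lemma lb_par A B (m : cost A) (n : cost B) w s w' s' :
  lb m w s -> lb n w' s' -> lb (par m n) (w + w') (maxn s s').
Proof.
move=> [mw ms] [nw ns]; split; apply: leqW; first exact: leq_add.
by rewrite geq_max !leq_max ms ns orbT.
Qed.

Lemma ub_seq_for (I : eqType) A (r : seq I) (f : A -> I -> cost A) a w s :
  (forall a i, i \in r -> ub (f a i) w s) ->
  ub (seq_for r f a) (size r * w) (size r * s).
Proof.
elim: r a => [|i r IH] a fb //=.
rewrite !mulSn; apply: ub_bind => [|a']; first by apply: fb; rewrite mem_head.
by apply: IH => a'' j rj; apply: fb; rewrite inE rj orbT.
Qed.

Lemma lb_seq_for (I : eqType) A (r : seq I) (f : A -> I -> cost A) a w s :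
  (forall a i, i \in r -> lb (f a i) w s) ->
  lb (seq_for r f a) (size r * w) (size r * s).
Proof.
elim: r a => [|i r IH] a fb //=.
rewrite !mulSn; apply: lb_bind => [|a']; first by apply: fb; rewrite mem_head.
by apply: IH => a'' j rj; apply: fb; rewrite inE rj orbT.
Qed.

Lemma sum_seq_const (I : eqType) (r : seq I) c : \sum_(i <- r) c = size r * c.
Proof. by rewrite big_const_seq count_predT iter_addn_0 mulnC. Qed.

Lemma ub_pfor (I : eqType) A (a0 : A) (r : seq I) f w s :
  (forall i, i \in r -> ub (f i) w s) ->
  ub (pfor a0 r f) (size r * w.+1) (ulg (size r) + 1 + s).
Proof.
move=> fb; split=> /=.
  rewrite -sum_seq_const big_seq [leqRHS]big_seq.
  by apply: leq_sum => i ri; rewrite ltnS; case: (fb i ri).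
rewrite addn1 leq_add2l big_seq; apply/bigmax_leqP_seq => i _ ri.
by case: (fb i ri).
Qed.

Lemma lb_pfor (I : eqType) A (a0 : A) (r : seq I) f w s :
  (forall i, i \in r -> lb (f i) w s) ->
  lb (pfor a0 r f) (size r * w.+1) (ulg (size r)).
Proof.
move=> fb; split=> /=; last by rewrite addSnnS leq_addr.
rewrite -sum_seq_const big_seq [leqRHS]big_seq.
by apply: leq_sum => i ri; rewrite ltnS; case: (fb i ri).
Qed.

Lemma lb_pfor_size (I : eqType) A (a0 : A) (r : seq I) f :
  lb (pfor a0 r f) (size r) (ulg (size r)).
Proof.
by have [] := @lb_pfor I A a0 r f 0 0 (fun i _ => lb0 (f i)); rewrite muln1.
Qed.

Lemma lb_pfor_in (I : eqType) A (a0 : A) (r : seq I) (f : I -> cost A) i w s :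
  i \in r -> lb (f i) w s -> lb (pfor a0 r f) w (ulg (size r) + s).
Proof.
move=> ri [fw fs]; split=> /=.
  by rewrite (big_rem i) //= addSn; apply: leqW; apply: leq_trans fw (leq_addr _ _).
by rewrite addSnnS leq_add2l; apply: leqW; apply: leq_trans fs _; apply: leq_bigmax_seq.
Qed.

(** The index [i] witnesses that the loop has an iteration, so that the maximum of the spans is at
    least [s]. *)
Lemma lb_pfor_all (I : eqType) A (a0 : A) (r : seq I) (f : I -> cost A) i w s :
  i \in r -> (forall j, j \in r -> lb (f j) w s) ->
  lb (pfor a0 r f) (size r * w.+1) (ulg (size r) + s).
Proof.
move=> ri fb; have [l1 _] := lb_pfor a0 fb.
by have [_ l2] := lb_pfor_in a0 ri (fb i ri).
Qed.

(** * Scalar subroutines and the one-dimensional fast Fourier transform *)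

Section Scalar.

Variable C : numClosedFieldType.

Lemma ub_seq_sum (I : eqType) (r : seq I) (f : I -> cost C) w :
  (forall i, i \in r -> ub (f i) w w) ->
  ub (seq_sum r f) (size r * w.+1) (size r * w.+1).
Proof.
move=> fb; apply: ub_seq_for => a i ri.
by rewrite -addn1; apply: ub_bind; [exact: fb | move=> v; exact: ub_op].
Qed.

(** Each halving of the exponent costs a squaring, a test and at most one product, hence the factor
    3. The induction is on an arbitrary fuel, since running out of it only lowers the cost. *)
Lemma ub_pow (x : C) n : ub (pow x n) (3 * (lg n).+1) (3 * (lg n).+1).
Proof.
rewrite /pow; move: {1}n => fuel.
elim: fuel x n => [|fuel IH] x n; first by [].
rewrite /=; case: eqP => [->|/eqP n0]; first by [].
have [n1|n1] := leqP n 1.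
  have -> : n = 1 by lia.
  rewrite trunc_log1 /= muln1; case: fuel {IH} => [|fuel] /=; split=> //.
rewrite trunc_log2S //= mulnS -[3 + _]/(1 + (2 + _)).
apply: ub_bind => // x2; rewrite addnC; apply: ub_bind => // y.
exact: ub_test.
Qed.

Lemma output_seq_for A I (r : seq I) (f : A -> I -> cost A) a :
  output (seq_for r f a) = foldl (fun a i => output (f a i)) a r.
Proof. by elim: r a => //= i r IH a. Qed.

Local Open Scope ring_scope.

Lemma output_seq_sum I (r : seq I) (f : I -> cost C) :
  output (seq_sum r f) = \sum_(i <- r) output (f i).
Proof.
rewrite /seq_sum output_seq_for.
suff H a : foldl (fun acc i => acc + output (f i)) a r
    = a + \sum_(i <- r) output (f i) by rewrite [LHS]H add0r.
elim: r a => [|i r IH] a /=; first by rewrite big_nil addr0.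
by rewrite IH big_cons addrA.
Qed.

Lemma output_pow (x : C) n : output (pow x n) = x ^+ n.
Proof.
rewrite /pow.
have: (n <= n)%N by [].
move: {2 3}n => fuel; elim: fuel x n => [|fuel IH] x n.
  by rewrite leqn0 => /eqP ->.
move=> nf /=; case: eqP => [->|/eqP n0]; first by rewrite expr0.
have IHn : output (pow_rec fuel (x * x) n./2) = x ^+ n./2.*2.
  by rewrite IH -?expr2 -?exprM ?mul2n //; lia.
rewrite /test /=; case: ifP => on /=; rewrite IHn -[in RHS](odd_double_half n) on //.
by rewrite -exprS.
Qed.

Lemma sum_ord_mul (V : nmodType) n1 n2 (F : nat -> V) :
  \sum_(j < n1 * n2) F j = \sum_(j1 < n1) \sum_(j2 < n2) F (n2 * j1 + j2)%N.
Proof.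
rewrite -(big_mkord xpredT F) big_nat_mul big_mkord; apply: eq_bigr => j1 _.
rewrite -{1}[(j1 * n2)%N]add0n big_addn mulSn addnK big_mkord.
by apply: eq_bigr => j2 _; rewrite addnC mulnC.
Qed.

(** Only the exponents below 2^k are prescribed: these are the entries that [roots2] writes. *)
Definition dft_table (k : nat) (z : C) (w : nat -> C) :=
  forall j, (j < 2 ^ k)%N -> w j = z ^+ j.

(** For k + 1 in place of k, the chain of square roots gives z^(2^k) = -1, so the order of z divides
    2^(k+1) but not 2^k. *)
Lemma root2_prim k :
  (0 < k)%N -> (2 ^ k).-primitive_root (output (root2 C false k)).
Proof.
case: k => // k _; rewrite /root2 /= output_seq_for /=.
set z := foldl _ _ _.
have zk : z ^+ (2 ^ k) = -1.
  rewrite {}/z; elim: k => [|k IH]; first by rewrite expr1.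
  by rewrite -[in iota 0 _]addn1 iotaD foldl_cat /= expnS exprM sqrtCK.
have z1 : z ^+ (2 ^ k.+1) = 1.
  by rewrite expnS mulnC exprM zk sqrrN expr1n.
have N1 : (-1 : C) != 1.
  by rewrite eq_sym -subr_eq0 opprK -(natrD _ 1 1) pnatr_eq0.
have [|m mp] := @prim_order_exists _ (2 ^ k.+1) z _ z1; first by rewrite expn_gt0.
move=> /(@dvdn_pfactor 2 _ _ isT)[j jk mE].
suff -> : k.+1 = j by rewrite -mE.
apply/eqP; rewrite eqn_leq jk andbT leqNgt; apply/negP => jk1.
move: zk; rewrite -(subnK (_ : j <= k)%N) // expnD mulnC exprM -mE.
rewrite (prim_expr_order mp) expr1n => /esym/eqP.
by rewrite (negPf N1).
Qed.

(* For [k = 0] the algorithm uses -1, but reads only its power of exponent 0. *)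
Definition zeta k : C := if k == 0%N then 1 else output (root2 C false k).

Lemma zeta_prim k : (2 ^ k).-primitive_root (zeta k).
Proof.
rewrite /zeta; case: eqP => [->|/eqP].
  by apply/andP; split=> //; apply/forallP => i; rewrite ord1 unity_rootE expr1 eqxx.
by rewrite -lt0n; apply: root2_prim.
Qed.

Definition zetai (inv : bool) k : C := if inv then (zeta k)^-1 else zeta k.

Lemma zetai_order inv k : zetai inv k ^+ (2 ^ k) = 1.
Proof. by case: inv; rewrite /= ?exprVn (prim_expr_order (zeta_prim k)) ?invr1. Qed.

Lemma output_roots2 inv k : dft_table k (zetai inv k) (output (roots2 C inv k)).
Proof.
move=> j jk; rewrite [LHS]/= mem_iota add0n jk /= output_pow.
case: k jk => [|k] jk; last by case: inv.
have -> : j = 0%N by move: jk; rewrite expn0; lia.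
by rewrite !expr0.
Qed.

Local Open Scope nat_scope.

Lemma ub_roots2 inv k : ub (roots2 C inv k) (2 ^ k * (4 * k + 6)) (5 * k + 6).
Proof.
have root_ub : ub (root2 C inv k) (k + 2) (k + 2).
  apply: ub_bind => [|z]; last by apply: (@ub_le _ _ 2 2); first exact: ub_test.
  have [|w s] := @ub_seq_for nat C (iota 0 k.-1) (fun z _ => op (sqrtC z)) (-1)%R 1 1.
    by [].
  by apply: ub_le (conj w s) _ _; rewrite size_iota; lia.
have rootsP z : ub (pfor (0 : C)%R (iota 0 (2 ^ k)) (fun j => pow z j))
    (2 ^ k * (3 * k.+1).+1) (k + 1 + 3 * k.+1).
  have := @ub_pfor nat C 0%R (iota 0 (2 ^ k)) (fun j => pow z j) (3 * k.+1) (3 * k.+1).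
  rewrite size_iota up_expnK //; apply=> j.
  rewrite mem_iota /= add0n => jk; apply: ub_le (ub_pow z j) _ _.
    by rewrite leq_mul2l ltnS /= -[leqRHS](trunc_expnK k (ltnSn 1)) leq_trunc_log // ltnW.
  by rewrite leq_mul2l ltnS /= -[leqRHS](trunc_expnK k (ltnSn 1)) leq_trunc_log // ltnW.
apply: ub_le (ub_bind root_ub rootsP) _ _; last by lia.
have : k < 2 ^ k by rewrite ltn_expl.
by nia.
Qed.

(** The subtracted 8 * 2^k makes the induction close: the two families of subtransforms together
    save 16 * 2^k, of which at most 8 * 2^k pays for the twiddle products, the final reads and the
    forks. The factor 17 comes from the base case k = 1, whose cost is 18 = 17 * 2 - 8 * 2. For the
    span, a split costs O(k) and [ulg] drops by one in each half. *)
Lemma ub_fft_rec fuel k w u : k <= fuel ->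
  ub (@fft_rec C fuel k w u) (17 * k * 2 ^ k + 5 * (k == 0) - 8 * (0 < k) * 2 ^ k)
     (10 * k * (ulg k).+1 + 5).
Proof.
elim: fuel k w u => [|fuel IH] k w u.
  by rewrite leqn0 => /eqP ->; split=> //=; rewrite !big_cons big_nil.
move=> kf; have [k1|k1] := leqP k 1; rewrite [fft_rec _ _ _ _]/= ?k1.
  apply: (@ub_le _ _ (2 ^ k * (2 ^ k * 4).+1) (k + 1 + 2 ^ k * 4)); last 2 first.
  - by case: k k1 {kf} => [|[]].
  - by case: k k1 {kf} => [|[]].
  have := @ub_pfor nat C 0%R (iota 0 (2 ^ k)).
  rewrite size_iota up_expnK //; apply=> m _.
  have := @ub_seq_sum nat (iota 0 (2 ^ k)); rewrite size_iota; apply=> j _.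
  by [].
rewrite leqNgt k1 /=.
set k1' := k./2; set k2 := k - k1'.
have k1k : 0 < k1' < k by rewrite /k1'; lia.
have k2k : 0 < k2 < k by rewrite /k2 /k1'; lia.
have kE : k = k1' + k2 by rewrite /k2; lia.
have uk1 : (ulg k1').+1 <= ulg k.
  rewrite -up_log2_double; last by lia.
  by apply: leq_up_log; rewrite /k1'; lia.
have uk2 : (ulg k2).+1 <= ulg k.
  have -> : k2 = (k.-1)./2.+1 by rewrite /k2 /k1'; lia.
  by rewrite -up_log2S ?prednK //; lia.
have A_ub : ub (pfor (fun _ => 0%R) (iota 0 (2 ^ k2)) (fun j2 =>
    @fft_rec C fuel k1' (fun j => w (2 ^ k2 * j)%N)
                         (fun j1 => u (2 ^ k2 * j1 + j2)%N)))
    (2 ^ k2 * (17 * k1' * 2 ^ k1' + 5 * (k1' == 0) - 8 * (0 < k1') * 2 ^ k1').+1) 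
    (k2 + 1 + (10 * k1' * (ulg k1').+1 + 5)).
  have := @ub_pfor nat (nat -> C) (fun=> 0%R) (iota 0 (2 ^ k2)).
  rewrite size_iota up_expnK //; apply=> m _.
  by apply: IH; lia.
pose B_b w' := (2 ^ k2 * (3).+1 + w').+1.
apply: ub_le (ub_bind A_ub
   (w' := 2 ^ k1' * B_b (17 * k2 * 2 ^ k2 + 5 * (k2 == 0) - 8 * (0 < k2) * 2 ^ k2) + 2 ^ k * 2)
   (s' := (k1' + 1 + ((k2 + 1 + 3) + (10 * k2 * (ulg k2).+1 + 5))) + (k + 1 + 1)) _) _ _.
- move=> A; apply: ub_bind => [|B].
    have := @ub_pfor nat (nat -> C) (fun=> 0%R) (iota 0 (2 ^ k1')).
    rewrite size_iota up_expnK //; apply=> m1 _.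
    apply: ub_bind => [|v]; last by apply: IH; lia.
    have := @ub_pfor nat C 0%R (iota 0 (2 ^ k2)).
    by rewrite size_iota up_expnK //; apply=> j2 _.
  have := @ub_pfor nat C 0%R (iota 0 (2 ^ k)).
  by rewrite size_iota up_expnK //; apply=> j2 _.
- have [-> -> ->] : [/\ (k1' == 0) = false, (k2 == 0) = false & (k == 0) = false].
    by split; lia.
  have [-> -> ->] : [/\ 0 < k1', 0 < k2 & 0 < k] by split; lia.
  rewrite /B_b kE expnD !muln0 !addn0 !muln1 -!mulnBl.
  move: (expn_gt0 2 k1') (expn_gt0 2 k2) => /=.
  move: (2 ^ k1') (2 ^ k2) => n1 n2 n1p n2p.
  have [l1 [l2 [-> ->]]] : exists l1 l2, k1' = l1.+1 /\ k2 = l2.+1.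
    by exists k1'.-1, k2.-1; lia.
  have -> : 17 * l1.+1 - 8 = 17 * l1 + 9 by lia.
  have -> : 17 * l2.+1 - 8 = 17 * l2 + 9 by lia.
  have -> : 17 * (l1.+1 + l2.+1) - 8 = 17 * l1 + 17 * l2 + 26 by lia.
  have n1P : n1 <= n1 * n2 by rewrite leq_pmulr.
  have n2P : n2 <= n1 * n2 by rewrite leq_pmull.
  apply: (@leq_trans (17 * (l1 * (n1 * n2)) + 17 * (l2 * (n1 * n2)) + 24 * (n1 * n2) + n1 + n2)).
    by apply: eq_leq; ring.
  apply: (@leq_trans (17 * (l1 * (n1 * n2)) + 17 * (l2 * (n1 * n2)) + 26 * (n1 * n2))).
    by lia.
  by apply: eq_leq; ring.
- have H1 : k1' * (ulg k1').+1 <= k1' * ulg k by rewrite leq_mul2l uk1 orbT.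
  have H2 : k2 * (ulg k2).+1 <= k2 * ulg k by rewrite leq_mul2l uk2 orbT.
  have -> : 10 * k * (ulg k).+1 = 10 * (k1' * ulg k + k2 * ulg k) + 10 * k.
    by rewrite -mulnDl -kE; ring.
  by rewrite -!mulnA; move: H1 H2 k1 k1k k2k kE; lia.
Qed.

Lemma ub_fft k w u :
  ub (@fft C k w u) (17 * k * 2 ^ k + 5) (10 * k * (ulg k).+1 + 5).
Proof.
apply: ub_le (ub_fft_rec _ _ (leqnn k)) _ _ => //.
apply: leq_trans (leq_subr _ _) _; case: k => [|k] /=; lia.
Qed.

(** The quantity k * 2^k is additive under the splitting, so the base cases already account for the
    work. The span comes from the fork trees alone, whose depths k1 and k2 add up to k at each of
    the lg k levels. *)
Lemma lb_fft_rec fuel k w u : k <= fuel ->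
  lb (@fft_rec C fuel k w u) (k * 2 ^ k) (k * lg k).
Proof.
elim: fuel k w u => [|fuel IH] k w u.
  by rewrite leqn0 => /eqP ->.
move=> kf; have [k1|k1] := leqP k 1; rewrite [fft_rec _ _ _ _]/= ?k1.
  have [lw _] := @lb_pfor_size nat C 0%R (iota 0 (2 ^ k)) (fun m =>
        seq_sum (iota 0 (2 ^ k)) (fun j =>
          bind (rd u j) (fun x => bind (rd w (j * m)%N) (fun z => op (z * x)%R)))).
  move: lw; rewrite size_iota => lw; split.
    by apply: leq_trans lw; case: k k1 {kf} => [|[]].
  by case: k k1 {kf lw} => [|[|]].
rewrite leqNgt k1 /=.
set k1' := k./2; set k2 := k - k1'.
have k1k : 0 < k1' < k by rewrite /k1'; lia.
have k2k : 0 < k2 < k by rewrite /k2 /k1'; lia.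
have kE : k = k1' + k2 by rewrite /k2; lia.
have lk1 : lg k = (lg k1').+1 by rewrite -trunc_log2S.
have lk2 : lg k <= (lg k2).+1.
  by rewrite lk1 ltnS; apply: leq_trunc_log; rewrite /k2 /k1'; lia.
apply: lb_le (lb_bind (w := 2 ^ k2 * (k1' * 2 ^ k1').+1) (s := k2 + k1' * lg k1')
  (w' := 2 ^ k1' * (k2 * 2 ^ k2).+1 + 0) (s' := k1' + k2 * lg k2 + 0) _ _) _ _.
- have r0 : 0 \in iota 0 (2 ^ k2) by rewrite mem_iota expn_gt0.
  have IH1 j2 : lb (@fft_rec C fuel k1' (fun j => w (2 ^ k2 * j)%N)
                         (fun j1 => u (2 ^ k2 * j1 + j2)%N)) (k1' * 2 ^ k1') (k1' * lg k1').
    by apply: IH; lia.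
  have := lb_pfor_all (fun=> 0%R) r0 (fun i _ => IH1 i).
  by rewrite size_iota up_expnK.
- move=> A; apply: lb_bind => [|B]; last exact: lb0.
  have r0 : 0 \in iota 0 (2 ^ k1') by rewrite mem_iota expn_gt0.
  have IH2 m1 : lb (bind (pfor 0%R (iota 0 (2 ^ k2)) (fun j2 =>
            bind (rd (A j2) m1) (fun x =>
            bind (rd w (j2 * m1)%N) (fun z => op (z * x)%R))))
        (fun v => fft_rec fuel k2 (fun j => w (2 ^ k1' * j)%N) v))
       (k2 * 2 ^ k2) (k2 * lg k2).
    rewrite -[k2 * 2 ^ k2]add0n -[k2 * lg k2]add0n.
    by apply: lb_bind => [|v]; [exact: lb0 | apply: IH; lia].
  have := lb_pfor_all (fun=> 0%R) r0 (fun i _ => IH2 i).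
  by rewrite size_iota up_expnK.
- rewrite kE expnD; move: (2 ^ k1') (2 ^ k2) => n1 n2; nia.
- by move: (lg k) (lg k1') (lg k2) lk1 lk2 => x y z; nia.
Qed.

Lemma lb_fft k w u : lb (@fft C k w u) (k * 2 ^ k) (k * lg k).
Proof. exact: lb_fft_rec. Qed.

Local Open Scope ring_scope.

Lemma output_fft_rec fuel k z w u m : (k <= fuel)%N ->
  dft_table k z w -> z ^+ (2 ^ k) = 1 -> (m < 2 ^ k)%N ->
  output (@fft_rec C fuel k w u) m = \sum_(j < 2 ^ k) z ^+ (j * m) * u j.
Proof.
elim: fuel k z w u m => [|fuel IH] k z w u m.
  rewrite leqn0 => /eqP -> wz _; rewrite expn0 ltnS leqn0 => /eqP -> /=.
  by rewrite big_ord1 /= expr0 mul1r.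
move=> kf wz z1 mk; have [k1|k1] := leqP k 1; rewrite [fft_rec _ _ _ _]/= ?k1.
  rewrite /pfor [LHS]/= mem_iota add0n mk /= output_seq_sum.
  have -> : iota 0 (2 ^ k) = index_iota 0 (2 ^ k) by rewrite /index_iota subn0.
  rewrite big_mkord.
  apply: eq_bigr => j _ /=; rewrite wz //.
  (* For k <= 1 the exponent j * m stays below 2^k, so the table is read within its range. *)
  by move: k k1 m mk j {kf wz z1} => [|[]] // _ [|[|m]] // _ [[|[|j]] jp].
rewrite leqNgt k1 /=.
set k1' := k./2; set k2 := (k - k1')%N.
have k1k : (0 < k1' < k)%N by rewrite /k1'; lia.
have k2k : (0 < k2 < k)%N by rewrite /k2 /k1'; lia.
have kE : k = (k1' + k2)%N by rewrite /k2; lia.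
have nE : (2 ^ k = 2 ^ k1' * 2 ^ k2)%N by rewrite {1}kE expnD.
move: (expn_gt0 2 k1') (expn_gt0 2 k2) => /= n1p n2p.
rewrite /pfor [LHS]/= mem_iota add0n mk /=.
rewrite !mem_iota !add0n ltn_mod n1p /=.
set m1 := (m %% _)%N; set m2 := (m %/ _)%N.
have m1p : (m1 < 2 ^ k1')%N by rewrite ltn_mod.
have m2p : (m2 < 2 ^ k2)%N by rewrite ltn_divLR // mulnC -nE.
have mE : m = (m2 * 2 ^ k1' + m1)%N by exact: divn_eq.
rewrite (IH k2 (z ^+ (2 ^ k1'))) //; [|lia| |by rewrite -exprM -nE]; last first.
  by move=> j jk2; rewrite wz ?nE ?ltn_pmul2l // exprM.
under [LHS]eq_bigr => j2 _.
  rewrite /= mem_iota add0n /= ltn_ord /=.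
  rewrite (IH k1' (z ^+ (2 ^ k2))) //; [|lia| |by rewrite -exprM mulnC -nE]; last first.
    by move=> j jk1; rewrite wz ?nE 1?mulnC ?ltn_pmul2r // mulnC exprM.
  (* The twiddle exponent j2 * m1 is below 2^k2 * 2^k1, again within the table. *)
  rewrite wz; last first.
    by rewrite nE mulnC; apply: leq_ltn_trans (_ : (m1 * 2 ^ k2 < _)%N);
      rewrite ?leq_mul2l ?ltn_pmul2r // ltnW ?orbT.
  rewrite mulrA mulr_sumr.
  over.
rewrite exchange_big /= nE (sum_ord_mul _ _ (fun j => z ^+ (j * m) * u j)).
apply: eq_bigr => j1 _; apply: eq_bigr => j2 _.
rewrite !mulrA -!exprM -!exprD; congr (_ * _).
(* The Cooley-Tukey identity: of the four parts of the exponent, two belong to the subtransforms,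
   one is the twiddle factor, and the last is a multiple of 2^k and vanishes. *)
have -> : ((2 ^ k2 * j1 + j2) * m = 2 ^ k1' * (j2 * m2) + j2 * m1
    + 2 ^ k2 * (j1 * m1) + 2 ^ k * (j1 * m2))%N by rewrite mE nE; nia.
by rewrite [RHS]exprD (exprM z (2 ^ k)) z1 expr1n mulr1.
Qed.

Lemma output_fft k z w u m :
  dft_table k z w -> z ^+ (2 ^ k) = 1 -> (m < 2 ^ k)%N ->
  output (@fft C k w u) m = \sum_(j < 2 ^ k) z ^+ (j * m) * u j.
Proof. exact: output_fft_rec. Qed.

End Scalar.

(** * Cells and discrete Fourier transforms *)

Local Open Scope nat_scope.

Section Box.

Variable d : nat.
Implicit Types (n : 'I_d -> nat) (x y : vec d).

Lemma mem_box n x :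
  (x \in box n) = [forall i, (0 <= x i)%R && (x i < (n i)%:Z)%R].
Proof.
apply/imageP/forallP => [[y _ ->] i|xb].
  by rewrite ffunE /= ltz_nat ltn_ord.
have xn i : `|x i| < n i by have /andP[x0 xn] := xb i; lia.
exists (finfun (fun i => Ordinal (xn i)) : {dffun forall i, 'I_(n i)}) => //.
by apply/ffunP => i; rewrite !ffunE /=; have /andP[x0 _] := xb i; lia.
Qed.

Lemma boxP n x :
  reflect (forall i, (0 <= x i)%R /\ (x i < (n i)%:Z)%R) (x \in box n).
Proof.
by rewrite mem_box; apply: (iffP forallP) => H i; apply/andP; apply: H.
Qed.

Lemma size_box n : size (box n) = \prod_(i < d) n i.
Proof.
rewrite size_map -cardE card_dep_ffun foldrE big_map big_enum /=.
by apply: eq_bigr => i _; rewrite card_ord.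
Qed.

Lemma updE x i j i' : upd x i j i' = if i' == i then (j%:Z)%R else x i'.
Proof. by rewrite ffunE. Qed.

Lemma upd_box n x i j : x \in box n -> j < n i -> upd x i j \in box n.
Proof.
move=> /boxP xb jn; apply/boxP => i'; rewrite updE; case: eqP => [->|_].
  by split; lia.
exact: xb.
Qed.

Lemma updK x i : (0 <= x i)%R -> upd x i `|x i|%N = x.
Proof.
move=> x0; apply/ffunP => i'; rewrite updE; case: eqP => // ->.
by rewrite gez0_abs.
Qed.

Lemma upd_upd x i j j' : upd (upd x i j) i j' = upd x i j'.
Proof. by apply/ffunP => i'; rewrite !updE; case: eqP. Qed.

Lemma updC x i i' j j' : i != i' -> upd (upd x i j) i' j' = upd (upd x i' j') i j.
Proof.
move=> ii'; apply/ffunP => l; rewrite !updE.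
by case: (l =P i') => // ->; rewrite eq_sym (negPf ii').
Qed.

Lemma box_abs n x i : x \in box n -> `|x i| < n i.
Proof. by move=> /boxP /(_ i) [x0 xn]; lia. Qed.

End Box.

Local Open Scope ring_scope.

(** * Multidimensional discrete Fourier transforms, one axis at a time *)

Section Dft.

Variables (C : fieldType) (d : nat) (n : 'I_d -> nat).
Implicit Types (z : 'I_d -> C) (a b : vec d -> C) (s : seq 'I_d).

Definition dft1 z i a (y : vec d) : C :=
  \sum_(j < n i) z i ^+ (j * `|y i|%N) * a (upd y i j).

Definition dft z s a : vec d -> C := foldl (fun a i => dft1 z i a) a s.

Lemma dft1_eq z i a b : {in box n, a =1 b} -> {in box n, dft1 z i a =1 dft1 z i b}.
Proof.
by move=> ab y yb; apply: eq_bigr => j _; rewrite ab // upd_box.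
Qed.

Lemma dft_eq z s a b : {in box n, a =1 b} -> {in box n, dft z s a =1 dft z s b}.
Proof. by elim: s a b => //= i s IH a b ab; apply: IH; apply: dft1_eq. Qed.

Lemma dft_sum (I : Type) (r : seq I) z s (c : I -> C) (f : I -> vec d -> C) :
  dft z s (fun x => \sum_(o <- r) c o * f o x)
  =1 fun y => \sum_(o <- r) c o * dft z s (f o) y.
Proof.
(* Arrays are functions compared pointwise, so the induction is stated for every [g] pointwise equal
   to the sum. *)
suff H s' g : g =1 (fun x => \sum_(o <- r) c o * f o x) ->
  dft z s' g =1 fun y => \sum_(o <- r) c o * dft z s' (f o) y by exact: H.
elim: s' g f => [|i s' IH] g f gE //= y.
rewrite (IH _ (fun o => dft1 z i (f o))) // => {}y.
rewrite /dft1; under eq_bigr => j _ do rewrite gE mulr_sumr.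
rewrite exchange_big /=; apply: eq_bigr => o _; rewrite mulr_sumr.
by apply: eq_bigr => j _; rewrite mulrCA.
Qed.

Lemma dft_scale z s g a :
  (forall i x j, i \in s -> g (upd x i j) = g x) ->
  dft z s (fun x => g x * a x) =1 fun y => g y * dft z s a y.
Proof.
move=> gs.
suff H s' b : {subset s' <= s} -> b =1 (fun x => g x * a x) ->
  dft z s' b =1 fun y => g y * dft z s' a y by exact: H.
elim: s' a b => [|i s' IH] a' b s's bE //= y.
rewrite (IH (dft1 z i a')) //.
  by move=> j js; apply: s's; rewrite inE js orbT.
move=> {}y; rewrite /dft1 mulr_sumr; apply: eq_bigr => j _.
have gi : g (upd y i j) = g y by apply/gs/s's/mem_head.
by rewrite bE gi mulrCA.
Qed.

Lemma dft1C z z' i j a : i != j ->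
  dft1 z i (dft1 z' j a) =1 dft1 z' j (dft1 z i a).
Proof.
move=> ij y; rewrite /dft1.
under eq_bigr => l _ do rewrite mulr_sumr.
under [RHS]eq_bigr => l _ do rewrite mulr_sumr.
rewrite exchange_big /=; apply: eq_bigr => l _; apply: eq_bigr => m _.
by rewrite !updE (negPf ij) eq_sym (negPf ij) mulrCA updC.
Qed.

Lemma dft1_dft z z' i s a : i \notin s ->
  {in box n, dft1 z i (dft z' s a) =1 dft z' s (dft1 z i a)}.
Proof.
elim: s a => [|j s IH] a //=; rewrite inE negb_or => /andP[ij si] y yb.
rewrite IH //; apply: dft_eq => // x xb; exact: dft1C.
Qed.

(** Orthogonality of characters: this is a geometric sum of ratio q = w^j / w^l, where q^m = 1 and q
    differs from 1 unless j = l. *)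
Lemma sum_prim_root (m : nat) (w : C) (j l : 'I_m) : m.-primitive_root w ->
  \sum_(h < m) w^-1 ^+ (h * l) * w ^+ (j * h) = (m * (j == l))%:R.
Proof.
move=> wp; have w1 := prim_expr_order wp.
have w0 : w != 0.
  apply/eqP => w0; move/eqP: w1.
  by rewrite w0 expr0n gtn_eqF ?(prim_order_gt0 wp) // eq_sym oner_eq0.
set q := w ^+ j / w ^+ l.
transitivity (\sum_(h < m) q ^+ h).
  apply: eq_bigr => h _.
  by rewrite expr_div_n -!exprM exprVn mulrC [(l * h)%N]mulnC.
have [jl|jl] := eqVneq j l.
  by rewrite muln1 /q jl divff ?expf_neq0 // (eq_bigr (fun=> 1)) ?sumr_const ?card_ord
    // => h _; rewrite expr1n.
rewrite muln0; apply/eqP; rewrite -(mulrI_eq0 _ (mulfI (_ : q - 1 != 0))).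
  by rewrite -subrX1 expr_div_n -!exprM ![(_ * m)%N]mulnC !exprM w1 !expr1n divr1 subrr.
rewrite subr_eq0 -(inj_eq (mulIf (expf_neq0 l w0))) mul1r divfK ?expf_neq0 //.
by rewrite (eq_prim_root_expr wp) !modn_small.
Qed.

Lemma dft1K z i a : (n i).-primitive_root (z i) ->
  {in box n, dft1 (fun j => (z j)^-1) i (dft1 z i a) =1 fun y => (n i)%:R * a y}.
Proof.
move=> zp y yb; rewrite /dft1.
under eq_bigr => h _ do rewrite mulr_sumr.
rewrite exchange_big /=.
pose l := Ordinal (box_abs i yb).
under eq_bigr => j _.
  under eq_bigr => h _ do rewrite updE eqxx absz_nat upd_upd mulrA -[`|y i|%N]/(val l).
  rewrite -mulr_suml sum_prim_root //; over.
rewrite (bigD1 l) //= eqxx muln1 updK; last by have [] := boxP _ _ yb i.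
rewrite big1 ?addr0 // => j /negPf jl.
by rewrite jl muln0 mul0r.
Qed.

(** Both transforms treat the axes in the same order, so the inverse along the first axis must
    commute past the forward transforms along the others before it cancels. *)
Lemma dftK z s a : uniq s -> (forall i, (n i).-primitive_root (z i)) ->
  {in box n, dft (fun j => (z j)^-1) s (dft z s a)
             =1 fun y => (\prod_(i <- s) n i)%:R * a y}.
Proof.
move=> + zp; elim: s a => [|i s IH] a /=.
  by move=> _ y _; rewrite big_nil mul1r.
move=> /andP[si us] y yb; rewrite big_cons natrM.
rewrite (dft_eq _ _ (dft1_dft _ _ _ si)) //.
rewrite IH // [RHS]mulrAC [RHS]mulrC; congr (_ * _).
exact: dft1K.
Qed.

(** Translation with wrap-around, restricted to the axes in [S] so that an induction can remove it
    one axis at a time. *)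
Definition shift (S : pred 'I_d) (v x : vec d) : vec d :=
  [ffun i => if S i then ((x i + v i) %% (n i)%:Z)%Z else x i].

(** The i-th factor of the character by which translation by [v] acts on the Fourier side. The
    residue of -v i serves as a natural exponent. *)
Definition shift_char z (v : vec d) i (y : vec d) : C :=
  z i ^+ (`|((- v i) %% (n i)%:Z)%Z|%N * `|y i|%N).

(** The map j -> j + v i is a permutation of the residues modulo n i; reindexing the sum by it
    trades the translation along axis i for the character. *)
Lemma dft1_shift z (S : pred 'I_d) v i a y :
  (0 < n i)%N -> z i ^+ n i = 1 -> S i -> y \in box n ->
  dft1 z i (fun x => a (shift S v x)) y
  = shift_char z v i y * dft1 z i a (shift [pred j | S j && (j != i)] v y).
Proof.
move=> n0 z1 Si yb.
have nZ : (n i)%:Z != 0 by lia.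
have hp (j : 'I_(n i)) : (`|((j%:Z + v i) %% (n i)%:Z)%Z| < n i)%N.
  have := ltz_mod (j%:Z + v i) nZ; have := modz_ge0 (j%:Z + v i) nZ.
  lia.
pose h j := Ordinal (hp j).
have hE (j : 'I_(n i)) : (h j)%:Z = ((j%:Z + v i) %% (n i)%:Z)%Z.
  by rewrite /= gez0_abs // modz_ge0.
have h_inj : injective h.
  move=> j j' hj.
  have : ((j%:Z + v i) = (j'%:Z + v i) %[mod (n i)%:Z])%Z by rewrite -!hE hj.
  move=> /eqP; rewrite eqz_modDr => /eqP.
  by rewrite !modz_small ?lez_nat ?ltz_nat //= => -[] /val_inj.
rewrite /dft1 [in RHS](reindex_inj h_inj) mulr_sumr /=.
apply: eq_bigr => j _; rewrite mulrA; congr (_ * a _).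
  rewrite /shift_char -exprD ffunE /= eqxx andbF.
  rewrite -mulnDl !exprM; congr (_ ^+ _).
  rewrite -[RHS](expr_mod _ z1) -[LHS](expr_mod _ z1); congr (_ ^+ _).
  apply/eqP; rewrite -eqz_nat -!modz_nat PoszD.
  have -> : `|((j%:Z + v i) %% (n i)%:Z)%Z|%:Z = ((j%:Z + v i) %% (n i)%:Z)%Z.
    by rewrite gez0_abs // modz_ge0.
  rewrite gez0_abs ?modz_ge0 // modzDm; apply/eqP; congr (_ %% _)%Z; lia.
apply/ffunP => i'; rewrite !ffunE /=.
by case: (i' =P i) => [->|/eqP ii']; rewrite ?Si ?andbT //= -hE.
Qed.

Lemma shift_char_upd z v i y i' j : i' != i ->
  shift_char z v i (upd y i' j) = shift_char z v i y.
Proof. by move=> ii'; rewrite /shift_char updE eq_sym (negPf ii'). Qed.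

Lemma dft_shift z s (S : pred 'I_d) v a :
  (forall i, 0 < n i)%N -> (forall i, z i ^+ n i = 1) -> uniq s -> {subset s <= S} ->
  {in box n, dft z s (fun x => a (shift S v x))
     =1 fun y => (\prod_(i <- s) shift_char z v i y)
                 * dft z s a (shift [pred j | S j && (j \notin s)] v y)}.
Proof.
move=> n0 z1; elim: s S a => [|i s IH] S a /=.
  move=> _ _ y _; rewrite big_nil mul1r; congr (a _).
  by apply/ffunP => j; rewrite !ffunE /= andbT.
move=> /andP[si us] sS y yb.
have Si : S i by apply: sS; rewrite mem_head.
rewrite (dft_eq _ _ (fun x => dft1_shift _ _ (n0 i) (z1 i) Si)) //.
(* The character of axis i is constant along the other axes, so it passes through the remaining
   transforms. *)
rewrite dft_scale => [|l x j ls]; last first.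
  by rewrite shift_char_upd //; apply: contraNneq si => <-.
rewrite (IH _ (dft1 z i a)) //; last first.
  move=> j js; rewrite inE [S j]sS ?inE ?js ?orbT //=.
  by apply: contraNneq si => <-.
rewrite big_cons mulrA; congr (_ * dft _ _ _ _).
by apply/ffunP => j; rewrite !ffunE /= inE negb_or andbA.
Qed.

Definition delta0 (S : pred 'I_d) (x : vec d) : C := [forall (i | S i), x i == 0]%:R.

(** Along an axis only the term j = 0 survives, with coefficient 1, which drops the constraint on
    that axis. Once all axes are treated, the unit impulse has become the constant 1. *)
Lemma dft_delta0 z s (S : pred 'I_d) : (forall i, 0 < n i)%N -> uniq s -> {subset s <= S} ->
  dft z s (delta0 S) =1 delta0 [pred j | S j && (j \notin s)].
Proof.
move=> n0.
suff H a : uniq s -> {subset s <= S} -> a =1 delta0 S ->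
   dft z s a =1 delta0 [pred j | S j && (j \notin s)] by move=> ? ?; exact: H.
elim: s S a => [|i s IH] S a /=.
  move=> _ _ aE y; rewrite aE /delta0; congr (_%:R : C).
  by congr nat_of_bool; apply: eq_forallb => j; rewrite /= andbT.
move=> /andP[si us] sS aE y.
have Si : S i by apply: sS; rewrite mem_head.
rewrite (IH [pred j | S j && (j != i)]) //.
- rewrite /delta0; congr (_%:R : C); congr nat_of_bool; apply: eq_forallb => j.
  by rewrite /= inE negb_or andbA.
- move=> j js; rewrite inE [S j]sS ?inE ?js ?orbT //=.
  by apply: contraNneq si => <-.
move=> {}y; rewrite /dft1 (bigD1 (Ordinal (n0 i))) //= expr0 mul1r aE big1 => [|j].
  rewrite addr0 /delta0; congr (_%:R : C); congr nat_of_bool.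
  apply/forall_inP/forall_inP => yS j.
    by move=> /andP[Sj /negPf ji]; have := yS j Sj; rewrite updE ji.
  move=> Sj; rewrite updE; case: ifPn => // ji.
  by apply: (yS j); rewrite /= Sj.
rewrite -val_eqE /= aE /delta0 => j0.
case: forall_inP => [/(_ i Si)|_]; last by rewrite mulr0.
by rewrite updE eqxx eqz_nat (negPf j0).
Qed.

End Dft.

(** * The periodic solver *)

Local Open Scope nat_scope.

Lemma lb_seq_for_in (I : eqType) A (r : seq I) (f : A -> I -> cost A) a i w s :
  i \in r -> (forall a, lb (f a i) w s) -> lb (seq_for r f a) w s.
Proof.
move=> + fb; elim: r a => //= j r IH a; rewrite inE => /predU1P[<-|ir].
  by rewrite -[w]addn0 -[s]addn0; apply: lb_bind => // a'; exact: lb0.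
by rewrite -[w]add0n -[s]add0n; apply: lb_bind => [|a']; [exact: lb0 | exact: IH].
Qed.

Section Fftn.

Variables (C : numClosedFieldType) (d : nat) (k : 'I_d -> nat).
Implicit Types (a : vec d -> C).

Let n := pow2 k.
Let K := \sum_(i < d) k i.

Lemma pow2_gt0 i : 0 < n i. Proof. by rewrite expn_gt0. Qed.

Lemma size_box_pow2 : size (box n) = 2 ^ K.
Proof. by rewrite size_box /n /pow2 -expn_sum. Qed.

Lemma leq_exp_sum i : k i <= K.
Proof. by rewrite /K (bigD1 i) //= leq_addr. Qed.

Let lines i := box (fun j => if j == i then 1 else n j).

Lemma size_lines i : size (lines i) = 2 ^ (K - k i).
Proof.
have -> : K - k i = \sum_(j < d | j != i) k j by rewrite /K (bigD1 i) //= addKn.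
rewrite size_box (bigD1 i) //= eqxx mul1n expn_sum.
by apply: eq_bigr => j /negPf ->.
Qed.

Lemma ub_fft_dim inv a i :
  ub (fft_dim inv k a i) (2 ^ K * (21 * K + 14)) (8 * K + 10 * (K * (ulg K).+1) + 14).
Proof.
have kK := leq_exp_sum i.
have uK : k i * (ulg (k i)).+1 <= K * (ulg K).+1.
  by apply: leq_mul => //; rewrite ltnS leq_up_log.
apply: ub_le (ub_bind (ub_roots2 C inv (k i))
  (w' := 2 ^ (K - k i) * (17 * k i * 2 ^ k i + 5).+1 + 2 ^ K * 2)
  (s' := K - k i + 1 + (10 * k i * (ulg (k i)).+1 + 5) + (K + 1 + 1)) _) _ _.
- move=> w; apply: ub_bind => [|L].
    have := @ub_pfor (vec d) (nat -> C) (fun=> 0%R) (lines i).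
    rewrite size_lines up_expnK //; apply=> x _; exact: ub_fft.
  have := @ub_pfor (vec d) C 0%R (box n).
  by rewrite size_box_pow2 up_expnK //; apply=> y _.
- rewrite -{2 3}(subnK kK) expnD.
  move: (expn_gt0 2 (K - k i)) (expn_gt0 2 (k i)) => /=.
  move: (2 ^ (K - k i)) (2 ^ k i) => N1 N2 N1p N2p.
  have H1 : N2 * (4 * k i + 6) <= N1 * N2 * (4 * K + 6).
    by apply: leq_mul; [rewrite leq_pmull | lia].
  have H2 : N1 * N2 * k i <= N1 * N2 * K by rewrite leq_mul2l kK orbT.
  have H3 : N1 <= N1 * N2 by rewrite leq_pmulr.
  rewrite (_ : N1 * (17 * k i * N2 + 5).+1 = 17 * (N1 * N2 * k i) + 6 * N1); last by ring.
  rewrite (_ : N1 * N2 * (4 * K + 6) = 4 * (N1 * N2 * K) + 6 * (N1 * N2)) in H1; last by ring.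
  rewrite (_ : N1 * N2 * (21 * K + 14) = 21 * (N1 * N2 * K) + 14 * (N1 * N2)); last by ring.
  by lia.
- lia.
Qed.

Lemma lb_fft_dim inv a i :
  lb (fft_dim inv k a i) (2 ^ K * k i) (K + k i * lg (k i)).
Proof.
have kK := leq_exp_sum i.
rewrite -[X in lb _ X]add0n -[X in lb _ _ X]add0n.
apply: lb_bind => [|w]; first exact: lb0.
apply: (@lb_le _ _ (2 ^ K * k i + 0) (k i * lg (k i) + K)); [|lia|lia].
apply: lb_bind => [|L]; last first.
  split=> //.
  have [_] := lb_pfor_size (0%R : C) (box n) (fun y => rd (L (upd y i 0)) `|(y i)|%N).
  by rewrite size_box_pow2 up_expnK.
have x0 : [ffun=> 0%R] \in lines i.
  apply/boxP => j; rewrite ffunE; split=> //; rewrite ltz_nat.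
  by case: eqP => // _; rewrite pow2_gt0.
have [] := lb_pfor_all (fun=> 0%R : C) x0
  (fun x _ => @lb_fft C (k i) w (fun j => a (upd x i j))).
rewrite size_lines up_expnK // => l1 l2; split.
  apply: leq_trans l1; rewrite -{1}(subnK kK) expnD -mulnA leq_mul2l.
  by rewrite mulnC leqnSn orbT.
by apply: leq_trans l2; rewrite leq_addl.
Qed.

Lemma ub_fftn inv a :
  ub (fftn inv k a) (d * (2 ^ K * (21 * K + 14)))
     (d * (8 * K + 10 * (K * (ulg K).+1) + 14)).
Proof.
have := @ub_seq_for 'I_d _ (enum 'I_d) (fft_dim inv k) a.
by rewrite size_enum_ord; apply=> b i _; exact: ub_fft_dim.
Qed.

Lemma lb_fftn inv a i : lb (fftn inv k a) (2 ^ K * k i) (K + k i * lg (k i)).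
Proof.
by apply: (@lb_seq_for_in _ _ _ _ _ i) => [|b]; [rewrite mem_enum | exact: lb_fft_dim].
Qed.

Local Open Scope ring_scope.

Let z inv i : C := zetai C inv (k i).

Lemma output_fft_dim inv a i :
  {in box n, output (fft_dim inv k a i) =1 dft1 n (z inv) i a}.
Proof.
move=> y yb; rewrite /fft_dim /pfor [LHS]/= yb /=.
have -> : upd y i 0 \in lines i.
  apply/boxP => j; rewrite updE; case: eqP => // _; exact: (boxP _ _ yb).
rewrite (@output_fft _ _ (z inv i)) ?zetai_order //.
- by apply: eq_bigr => j _; rewrite upd_upd.
- exact: output_roots2.
- exact: (box_abs i yb).
Qed.

Lemma output_fftn inv a :
  {in box n, output (fftn inv k a) =1 dft n (z inv) (enum 'I_d) a}.
Proof.
rewrite /fftn output_seq_for.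
suff H s b : {in box n, a =1 b} ->
    {in box n, foldl (fun a i => output (fft_dim inv k a i)) a s
               =1 dft n (z inv) s b} by exact: H.
elim: s a b => [|i s IH] a' b ab //.
apply: (IH (output (fft_dim inv k a' i)) (dft1 n (z inv) i b)) => y yb.
by rewrite output_fft_dim //; exact: dft1_eq.
Qed.

(** * Diagonalization of the periodic step *)

Variables (sigma : nat) (p : stencil_problem C d sigma).

Definition periodic_step a (x : vec d) : C :=
  \sum_(o : offset d sigma) coef p o * a (shift n predT (offv o) x).

Let zp i : (n i).-primitive_root (z false i).
Proof. exact: zeta_prim. Qed.

(** The symbol of the stencil: the factor by which one periodic step multiplies the Fourier mode
    y. *)
Definition eigenvalue (y : vec d) : C :=
  \sum_(o : offset d sigma) coef p o *
    \prod_(i <- enum 'I_d) shift_char n (z false) (offv o) i y.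

Let F := dft n (z false) (enum 'I_d).

Lemma dft_periodic_step a :
  {in box n, F (periodic_step a) =1 fun y => eigenvalue y * F a y}.
Proof.
move=> y yb; rewrite /F /periodic_step dft_sum mulr_suml.
apply: eq_bigr => o _; rewrite -mulrA; congr (_ * _).
rewrite dft_shift ?enum_uniq //.
- congr (_ * dft _ _ _ _ _); apply/ffunP => i.
  by rewrite ffunE /= mem_enum.
- exact: pow2_gt0.
- by move=> i; exact: prim_expr_order.
Qed.

Lemma dft_iter_periodic_step h a :
  {in box n, F (iter h periodic_step a) =1 fun y => eigenvalue y ^+ h * F a y}.
Proof.
elim: h => [|h IH] y yb /=; first by rewrite mul1r.
by rewrite dft_periodic_step // IH // exprS mulrA.
Qed.

(** The congruence between -o and y says that translating y by o wraps to the origin, where the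
    impulse sits. *)
Lemma kernel_impulse (y : vec d) : y \in box n ->
  \sum_(o <- enum (offset d sigma))
     (if [forall i, (- offv o i == y i %[mod (n i)%:Z])%Z] then coef p o else 0)
  = periodic_step (delta0 _ predT) y.
Proof.
move=> yb; rewrite big_enum /=; apply: eq_bigr => o _.
rewrite /delta0 [in RHS](_ : [forall (i | _), _] = [forall i, (- offv o i == y i %[mod (n i)%:Z])%Z]).
  by case: ifP; rewrite ?mulr1 ?mulr0.
apply: eq_forallb => i; rewrite ffunE /=.
by rewrite [RHS]eq_sym eqz_mod_dvd opprK; apply/eqP/dvdz_mod0P.
Qed.

Lemma output_stencilFFT_P h a :
  {in box n, output (stencilFFT_P p k h a) =1 iter h periodic_step a}.
Proof.
move=> y yb; rewrite /stencilFFT_P !output_bind output_pfor yb output_bind.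
set c := output (pfor 0 _ (fun y => seq_sum _ _)).
have cE : {in box n, c =1 periodic_step (delta0 _ predT)}.
  move=> x xb; rewrite /c output_pfor xb output_seq_sum -kernel_impulse //.
  by apply: eq_bigr => o _; rewrite output_test.
have lE : {in box n, output (fftn false k c) =1 eigenvalue}.
  move=> x xb; rewrite output_fftn // (dft_eq _ _ cE) // -/F dft_periodic_step //.
  rewrite /F dft_delta0 ?enum_uniq //; last exact: pow2_gt0.
  rewrite /delta0 (_ : [forall (i | _), _] = true) ?mulr1 //.
  by apply/forallP => i; rewrite /= mem_enum.
have N0 : (\prod_(i < d) pow2 k i)%:R != 0 :> C.
  by rewrite pnatr_eq0 -lt0n prodn_gt0 // => i; exact: pow2_gt0.
rewrite output_op output_rd output_fftn //.
(* The pointwise product is the transform of the h-th iterate, so the inverse transform only has to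
   cancel a forward one. *)
rewrite (dft_eq _ _ (b := F (iter h periodic_step a))) //; last first.
  move=> x xb; rewrite output_pfor xb !output_bind output_op !output_rd output_pow.
  by rewrite lE // output_fftn // dft_iter_periodic_step.
rewrite -[dft _ _ _ _ _]/(dft n (fun i => (z false i)^-1) _ _ _) dftK ?enum_uniq //.
by rewrite big_enum /= mulrC mulKf.
Qed.

Local Open Scope nat_scope.

Let M := #|offset d sigma|.

Lemma ub_kernel (f : vec d -> offset d sigma -> bool) :
  ub (pfor 0%R (box n) (fun y =>
    seq_sum (enum (offset d sigma)) (fun o => test (f y o) (rd (coef p) o) (ret 0%R))))
   (2 ^ K * (M * 3).+1) (K + 1 + M * 3).
Proof.
have := @ub_pfor (vec d) C 0%R (box n); rewrite size_box_pow2 up_expnK //; apply=> y _.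
have := @ub_seq_sum C (offset d sigma) (enum (offset d sigma)).
rewrite -cardE; apply=> o _; apply: (@ub_le _ _ 2 2) => //.
by apply: ub_test => //; apply: (@ub_le _ _ 0 0).
Qed.

(** 63 = 3 * 21 covers the three multidimensional transforms, 3 * M the kernel table, and 20 the
    powers and the pointwise loops. *)
Definition fft_const := 63 * d + 3 * M + 20.

Lemma ub_stencilFFT_P h a :
  ub (stencilFFT_P p k h a) (fft_const * (2 ^ K * (K + lg h + 1)))
     (fft_const * (K * (ulg K).+1 + lg h + 1)).
Proof.
apply: ub_le (ub_bind (ub_kernel _) (fun c => ub_bind (ub_fftn false c) (fun Fc =>
  ub_bind (ub_fftn false a) (fun Fa => ub_bind
   (w := 2 ^ K * (3 * (lg h).+1 + 3).+1) (s := K + 1 + (3 * (lg h).+1 + 3)) _ (fun Fb =>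
   ub_bind (ub_fftn true Fb)
   (w' := 2 ^ K * 3) (s' := K + 1 + 2) _))))) _ _.
- move=> _ Fc Fa; have := @ub_pfor (vec d) C 0%R (box n).
  rewrite size_box_pow2 up_expnK //; apply=> y _.
  apply: (@ub_le _ _ (1 + (3 * (lg h).+1 + 2)) (1 + (3 * (lg h).+1 + 2))); try lia.
  apply: ub_bind => // l; apply: ub_bind => [|lh]; first exact: ub_pow.
  exact: (@ub_le _ _ 2 2).
- move=> _ _ _ _ b; have := @ub_pfor (vec d) C 0%R (box n).
  by rewrite size_box_pow2 up_expnK //; apply=> y _.
- rewrite /fft_const; move: (2 ^ K) (lg h) => N l.
  rewrite [d * _]mulnCA -!mulnDr [leqRHS]mulnCA leq_mul2l; apply/orP; right.
  rewrite (_ : d * (21 * K + 14) = 21 * (d * K) + 14 * d); last by ring.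
  rewrite (_ : (63 * d + 3 * M + 20) * (K + l + 1) = 63 * (d * K) + 63 * (d * l) + 63 * d
    + 3 * (M * K) + 3 * (M * l) + 3 * M + 20 * (K + l + 1)); last by ring.
  by move: (M * K) (M * l) (d * K) (d * l) => *; lia.
- have KK : K <= K * (ulg K).+1 by rewrite leq_pmulr.
  rewrite /fft_const; move: (K * (ulg K).+1) (lg h) KK => Q l KK.
  have H1 : d * K <= d * Q by rewrite leq_mul2l KK orbT.
  rewrite (_ : d * (8 * K + 10 * Q + 14) = 8 * (d * K) + 10 * (d * Q) + 14 * d); last by ring.
  rewrite (_ : (63 * d + 3 * M + 20) * (Q + l + 1) = 63 * (d * Q) + 63 * (d * l) + 63 * d
    + 3 * (M * Q) + 3 * (M * l) + 3 * M + 20 * (Q + l + 1)); last by ring.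
  by move: (M * Q) (M * l) (d * K) (d * Q) (d * l) H1 => *; lia.
Qed.

Lemma lb_stencilFFT_P h a i :
  lb (stencilFFT_P p k h a) (2 ^ K * k i) (K + k i * lg (k i)).
Proof.
rewrite -[X in lb _ X]add0n -[X in lb _ _ X]add0n.
apply: lb_bind => [|c]; first exact: lb0.
rewrite -[X in lb _ X]addn0 -[X in lb _ _ X]addn0.
apply: lb_bind => [|Fc]; [exact: lb_fftn | exact: lb0].
Qed.

End Fftn.

(** * Correctness of the aperiodic solver *)

Local Open Scope ring_scope.

Section Aperiodic.

Variables (C : numClosedFieldType) (d sigma : nat) (p : stencil_problem C d sigma).
Implicit Types (x y u : vec d) (f : face d) (a : vec d -> C) (o : offset d sigma).

Lemma addvE x y i : (x + y) i = x i + y i.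
Proof. by rewrite ffunE. Qed.

Lemma subvE x y i : (x - y) i = x i - y i.
Proof. by rewrite !ffunE. Qed.

Lemma innerP m x :
  reflect (forall i, m%:Z <= x i /\ x i < (extent p i)%:Z - m%:Z) (inner p m x).
Proof. by apply: (iffP forallP) => H i; apply/andP; apply: H. Qed.

Lemma inner_le m m' x : (m <= m')%N -> inner p m' x -> inner p m x.
Proof.
by move=> mm' /innerP xi; apply/innerP => i; have [? ?] := xi i; split; lia.
Qed.

Lemma inner0_box x : inner p 0 x = (x \in box (extent p)).
Proof. by rewrite mem_box; apply: eq_forallb => i; rewrite subr0. Qed.

Lemma offv_bound o i : - sigma%:Z <= offv o i <= sigma%:Z.
Proof. by rewrite ffunE; have := ltn_ord (o i); lia. Qed.

Lemma inner_offv m x o : inner p (sigma + m) x -> inner p m (x + offv o).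
Proof.
move=> /innerP xi; apply/innerP => i; have [? ?] := xi i.
by have := offv_bound o i; rewrite addvE; split; lia.
Qed.

Lemma dist_offv f x o : dist p f (x + offv o) <= dist p f x + sigma%:Z.
Proof.
by have := offv_bound o f.1; rewrite /dist addvE; case: f.2; lia.
Qed.

Lemma not_inner_dist m x :
  ~~ inner p m x -> exists f, dist p f x < m%:Z.
Proof.
rewrite negb_forall => /existsP[i]; rewrite negb_and => /orP[xi|xi].
  by exists (i, false); rewrite /dist /=; lia.
by exists (i, true); rewrite /dist /=; lia.
Qed.

Lemma slab_extentP f w x : inner p 0 x -> dist p f x < w%:Z ->
  x - slab_origin p f w \in box (slab_extent p f w).
Proof.
move=> /innerP xi dx; apply/boxP => j; rewrite subvE.
rewrite ffunE /slab_extent; have [? ?] := xi j.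
case: eqP dx => [->|_] /=; rewrite /dist; last by lia.
by have [? ?] := xi f.1; case: f.2; split; lia.
Qed.

Lemma slab_extentE f w x : inner p 0 x -> x - slab_origin p f w \in box (slab_extent p f w) ->
  dist p f x < w%:Z.
Proof.
move=> /innerP xi /boxP /(_ f.1); rewrite subvE.
rewrite ffunE /slab_extent eqxx /=; rewrite /dist; have [? ?] := xi f.1.
by case: f.2; lia.
Qed.

Lemma mem_strip w x : inner p 0 x ->
  reflect (exists f, dist p f x < w%:Z) (x \in strip p w).
Proof.
move=> xi; apply: (iffP flatten_mapP) => [[f _ /mapP[y yb xE]]|[f fx]].
  exists f; apply: slab_extentE => //.
  by rewrite xE addrK.
exists f; first by rewrite mem_enum.
by apply/mapP; exists (x - slab_origin p f w); rewrite ?subrK // slab_extentP.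
Qed.

Lemma box_pow2 (e : 'I_d -> nat) x :
  x \in box e -> x \in box (pow2 (fun i => up_log 2 (e i))).
Proof.
move=> /boxP xb; apply/boxP => i; have [x0 xe] := xb i; split=> //.
by apply: lt_le_trans xe _; rewrite lez_nat up_logP.
Qed.

Lemma evolution_inner t x : inner p sigma x ->
  evolution p t.+1 x = \sum_o coef p o * evolution p t (x + offv o).
Proof. by rewrite /= /step => ->. Qed.

(* Inside the domain of dependence [Q], which shrinks with the number of steps
   and never meets the boundary of the box, the periodic solver agrees with
   the aperiodic evolution. *)
Lemma periodic_evolution (k : 'I_d -> nat) u (Q : nat -> vec d -> Prop) t a :
  (forall s x, Q s.+1 x -> inner p sigma x /\ forall o, Q s (x + offv o)) ->
  (forall s x, Q s x -> x - u \in box (pow2 k)) ->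
  (forall x, Q 0 x -> a (x - u) = evolution p t x) ->
  forall s x, Q s x -> iter s (periodic_step k p) a (x - u) = evolution p (t + s) x.
Proof.
move=> Qstep Qbox Q0; elim=> [|s IH] x Qx; first by rewrite addn0 /= Q0.
have [xi Qo] := Qstep _ _ Qx.
rewrite addnS evolution_inner //=; apply: eq_bigr => o _; congr (_ * _).
rewrite -IH //; congr (iter _ _ _ _); apply/ffunP => i.
have /boxP /(_ i) := Qbox _ _ (Qo o).
rewrite ![in _ /\ _]ffunE !ffunE /= => -[ge0 ltn].
by rewrite -[RHS](modz_small (d := (pow2 k i)%:Z)) ?ge0 //; congr (_ %% _)%Z; ring.
Qed.

(** The clause outside the grid matches the default 0 of [window], so that the boundary rule can be
    fed by unguarded reads of the table. *)
Definition good t w a :=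
  (forall x, inner p 0 x -> (exists f, dist p f x < w%:Z) -> a x = evolution p t x)
  /\ (forall x, ~~ inner p 0 x -> a x = 0).

Lemma good_le t w w' a : (w' <= w)%N -> good t w a -> good t w' a.
Proof.
move=> ww' [ae a0]; split=> // x xi [f fx]; apply: ae => //; exists f.
by apply: lt_le_trans fx _; rewrite lez_nat.
Qed.

Lemma output_stepM t w a x : good t (w + sigma) a -> inner p 0 x ->
  (exists f, dist p f x < w%:Z) -> output (stepM p t a x) = evolution p t.+1 x.
Proof.
move=> [ae a0] xi [f fx].
have aE o : inner p 0 (x + offv o) -> a (x + offv o) = evolution p t (x + offv o).
  move=> xo; apply: ae => //; exists f.
  by have := dist_offv f x o; rewrite PoszD; lia.
rewrite /stepM output_test [RHS]/= /step; case: ifP => xs.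
  rewrite output_seq_sum big_enum /=; apply: eq_bigr => o _.
  by rewrite aE //; apply: inner_offv; rewrite addn0.
rewrite output_test xi output_bind output_op; congr bc; apply/ffunP => o.
rewrite !ffunE output_pfor mem_enum output_rd.
by case: ifPn => [/aE|/a0].
Qed.

(** Every step recomputes the whole strip of width [W], but the width on which the values are known
    to be right shrinks by sigma per step. *)
Lemma good_direct w W t h a : (w + sigma * h <= W)%N ->
  good t (w + sigma * h) a -> good (t + h) w (output (direct p W t h a)).
Proof.
rewrite /direct; elim: h t a => [|h IH] t a; first by rewrite muln0 !addn0.
move=> wW ga; rewrite addnS -addSn.
apply: IH; first by lia.
have [_ a0] := ga.
split=> x xi; rewrite output_pfor.
  move=> fx; case: ifPn => [_|/negP[]].
    by apply: output_stepM fx => //; move: ga; rewrite mulnS addnCA addnC.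
  apply/mem_strip => //; case: fx => f fx; exists f; apply: lt_le_trans fx _.
  by rewrite lez_nat; lia.
case: ifP => // _; rewrite /stepM !output_test (negPf xi).
by rewrite ifF //; apply: contraNF xi => /inner_le; apply.
Qed.

Lemma output_free_slabs w h t a f x : good t w a -> inner p (sigma * h) x ->
  dist p f x + (sigma * h)%:Z < w%:Z ->
  output (free_slabs p w h a) f (x - slab_origin p f w) = evolution p (t + h) x.
Proof.
move=> [ae a0] xi fx; have fE : f \in enum {: face d} by rewrite mem_enum.
rewrite /free_slabs output_pfor fE output_bind.
set k := fun j => up_log 2 _.
(* After s steps the trusted cells keep two margins of sigma * s: one from the grid boundary, one
   from the inner side of the slab, where the zero padding or the wrap-around could interfere. *)
pose Q s x := inner p (sigma * s) x /\ dist p f x + (sigma * s)%:Z < w%:Z.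
have Qbox s y : Q s y -> y - slab_origin p f w \in box (pow2 k).
  by move=> [yi fy]; apply: box_pow2; apply: slab_extentP; [exact: inner_le yi | lia].
rewrite output_stencilFFT_P; last by apply: (Qbox h).
apply: (periodic_evolution (Q := Q)) => // [s y [yi fy]|y [yi fy]].
  split; first by apply: inner_le yi; rewrite mulnS leq_addr.
  move=> o; split; first by apply: inner_offv; rewrite -mulnS.
  by have := dist_offv f y o; move: fy; rewrite mulnS PoszD; lia.
rewrite muln0 addr0 in yi fy; rewrite output_pfor (Qbox 0%N) ?output_rd ?subrK.
  by apply: ae => //; exists f.
by split; rewrite muln0 ?addr0.
Qed.

(** A strip cell within sigma * h of the boundary is covered by [a']; any other one lies in a slab,
    at least sigma * h away from its inner side. *)
Lemma good_merge w h t ev a' : (sigma * h <= w)%N ->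
  good (t + h) (sigma * h) a' ->
  (forall f x, inner p (sigma * h) x -> dist p f x + (sigma * h)%:Z < w%:Z ->
     ev f (x - slab_origin p f w) = evolution p (t + h) x) ->
  good (t + h) (w - sigma * h) (output (Defs.merge p w h ev a')).
Proof.
move=> hw [a'e a'0] evE; split=> x xi; rewrite output_pfor.
  move=> fx; rewrite (introT (mem_strip _ xi)) // output_test.
  case: ifPn => xh; last by rewrite output_rd a'e //; exact: not_inner_dist.
  case: pickP => [f|] fx'; last by case: fx => f; rewrite fx'.
  by rewrite output_rd evE //; lia.
case: ifP => // _; rewrite output_test ifF ?output_rd ?a'0 //.
by apply: contraNF xi => /inner_le; apply.
Qed.

Lemma recursive_boundaryS fuel tau T t a :
  recursive_boundary p fuel.+1 tau T t a =
  test (T <= tau)%N (direct p (2 * sigma * tau) t T a)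
    (let h1 := T./2 in
     let h2 := (T - h1)%N in
     let w1 := (2 * sigma * T)%N in
     let w2 := (w1 - sigma * h1)%N in
     bind (par (free_slabs p w1 h1 a) (recursive_boundary p fuel tau h1 t a)) (fun r1 =>
     bind (Defs.merge p w1 h1 r1.1 r1.2) (fun a1 =>
     bind (par (free_slabs p w2 h2 a1)
               (recursive_boundary p fuel tau h2 (t + h1) a1)) (fun r2 =>
     Defs.merge p w2 h2 r2.1 r2.2)))).
Proof. by []. Qed.

Lemma good_recursive_boundary fuel tau T t a : (T <= fuel)%N -> (0 < tau)%N ->
  good t (2 * sigma * T) a ->
  good (t + T) (sigma * T) (output (recursive_boundary p fuel tau T t a)).
Proof.
move=> + tau0; elim: fuel T t a => [|fuel IH] T t a.
  by rewrite leqn0 => /eqP -> /=; rewrite !muln0 addn0.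
move=> Tf ga; rewrite recursive_boundaryS output_test; case: leqP => Tt.
  apply: good_direct; last by move: ga; rewrite -mulnA mul2n addnn.
  by rewrite addnn -mul2n mulnA leq_mul2l Tt orbT.
set h1 := T./2; set h2 := (T - h1)%N.
have h1T : (h1 < T)%N by rewrite /h1; lia.
have h2T : (h2 < T)%N by rewrite /h2 /h1; lia.
have hE : (h1 + h2 = T)%N by rewrite /h2; lia.
have h12 : (h1 <= h2)%N by rewrite /h2 /h1; lia.
(* Width accounting: out of 2 * sigma * T the halves consume sigma * h1 and sigma * h2, which leaves
   sigma * T. The second call needs 2 * sigma * h2, and sigma * h1 + 2 * sigma * h2 is available. *)
set w1 := (2 * sigma * T)%N; set w2 := (w1 - sigma * h1)%N.
have sE : (sigma * T = sigma * h1 + sigma * h2)%N by rewrite -mulnDr hE.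
have sh : (sigma * h1 <= sigma * h2)%N by rewrite leq_mul2l h12 orbT.
rewrite !output_bind; set a1 := output (Defs.merge _ w1 h1 _ _).
have ga1 : good (t + h1) w2 a1.
  apply: good_merge; first by rewrite /w1 -mulnA; lia.
    by apply: IH; [lia | apply: good_le ga; rewrite leq_mul2l ltnW ?orbT].
  by move=> f x xi fx; apply: output_free_slabs.
have -> : (sigma * T = w2 - sigma * h2)%N by rewrite /w2 /w1 -mulnA; lia.
have -> : (t + T = t + h1 + h2)%N by lia.
apply: good_merge.
- by rewrite /w2 /w1 -mulnA; lia.
- by apply: IH; [lia | apply: good_le ga1; rewrite /w2 /w1 -!mulnA; lia].
- by move=> f x xi fx; apply: output_free_slabs.
Qed.

Lemma output_stencilFFT_A T x : inner p 0 x -> output (stencilFFT_A p T) x = evolution p T x.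
Proof.
move=> xi; rewrite /stencilFFT_A !output_bind output_pfor -inner0_box xi output_test.
set a := output (pfor _ _ _).
have aE y : inner p 0 y -> a y = init p y by rewrite /a output_pfor -inner0_box => ->.
set k := fun i => up_log 2 (extent p i).
case: ifPn => xT; rewrite output_rd output_par.
  rewrite [(_, _).1]/fst output_stencilFFT_P; last by apply: box_pow2; rewrite -inner0_box.
  rewrite -[x in LHS]subr0 -[T in RHS]add0n.
  apply: (periodic_evolution (Q := fun s y => inner p (sigma * s) y)) => //.
  - move=> s y yi; split=> [|o]; first by apply: inner_le yi; rewrite mulnS leq_addr.
    by apply: inner_offv; rewrite -mulnS.
  - by move=> s y yi; rewrite subr0; apply: box_pow2; rewrite -inner0_box; apply: inner_le yi.
  - by move=> y; rewrite muln0 subr0 => /aE.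
(* The initial table is right on the whole grid, hence on a strip of any width, even one wider than
   the grid. *)
have ga : good 0 (2 * sigma * T) a.
  split=> y yi; first by rewrite aE.
  by rewrite /a output_pfor -inner0_box (negPf yi).
have c0 : (0 < cutoff p T)%N by rewrite muln_gt0.
have [+ _] := good_recursive_boundary (leqnn T) c0 ga.
rewrite add0n => ae; exact: ae xi (not_inner_dist xT).
Qed.

End Aperiodic.

(** * Slabs *)

Local Open Scope nat_scope.

Lemma lgM m n : lg (m * n) <= lg m + lg n + 1.
Proof.
have [->|m0] := posnP m; first by rewrite mul0n trunc_log0.
have [->|n0] := posnP n; first by rewrite muln0 trunc_log0.
rewrite addn1 -ltnS -(ltn_exp2l _ _ (ltnSn 1)).
apply: leq_ltn_trans (trunc_logP (ltnSn 1) _) _; first by rewrite muln_gt0 m0.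
apply: leq_trans (ltn_mul (trunc_log_ltn m (ltnSn 1)) (trunc_log_ltn n (ltnSn 1))) _.
by rewrite -expnD leq_exp2l //; lia.
Qed.

Lemma ulgM m n : ulg (m * n) <= ulg m + ulg n.
Proof. by apply: up_log_min => //; rewrite expnD leq_mul ?up_logP. Qed.

Lemma ulg_leq_pred n : ulg n <= n.-1.
Proof.
case: n => [|n]; first by rewrite up_log0.
by apply: up_log_min => //; exact: ltn_expl.
Qed.

Lemma ulg_leq_lg n : ulg n <= (lg n).+1.
Proof. by apply: up_log_min => //; apply: ltnW; exact: trunc_log_ltn. Qed.

Lemma lg_leq_ulg n : lg n <= ulg n.
Proof.
have [->|n0] := posnP n; first by rewrite trunc_log0.
rewrite -(leq_exp2l _ _ (ltnSn 1)); apply: leq_trans (trunc_logP _ n0) _ => //.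
exact: up_logP.
Qed.

Lemma lg_leq n : lg n <= n.
Proof. by apply: leq_trans (lg_leq_ulg n) (leq_trans (ulg_leq_pred n) (leq_pred n)). Qed.

(** [lg] drops by exactly one for the half rounded down, while [ulg] drops by at least one for both
    halves, including the one rounded up. *)
Lemma half_bounds T : 1 < T ->
  let h1 := T./2 in let h2 := T - h1 in
  [/\ 0 < h1 < T, 0 < h2 < T, h1 + h2 = T, lg T = (lg h1).+1
    & [/\ lg h1 <= lg h2, (ulg h1).+1 <= ulg T & (ulg h2).+1 <= ulg T]].
Proof.
move=> T1 h1 h2.
have h1E : h1 <= h2 <= h1.+1 by rewrite /h2 /h1; lia.
split; [by rewrite /h1; lia|by rewrite /h2 /h1; lia|by rewrite /h2 /h1; lia| |].
  exact: trunc_log2S.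
split; first by apply: leq_trunc_log; lia.
  by rewrite -up_log2_double ?leq_up_log // /h1; lia.
have -> : ulg T = (ulg (T.-1./2.+1)).+1 by rewrite -up_log2S ?prednK //; lia.
by rewrite ltnS leq_up_log // /h2 /h1; lia.
Qed.

(** * Sizes of strips and slabs, and the costs of the operations on them *)

Section Costs.

Variables (C : numClosedFieldType) (d sigma : nat) (p : stencil_problem C d sigma).
Implicit Types (x y : vec d) (f : face d) (a : vec d -> C) (o : offset d sigma).

Let b := num_boundary_cells p.
Let N := num_cells p.
Let e := extent p.

Definition area f := \prod_(j | j != f.1) e j.
Definition total_area := \sum_f area f.
Let S := total_area.

Lemma prod_slab_extent f w : \prod_j slab_extent p f w j = w * area f.
Proof.
rewrite (bigD1 f.1) //= /slab_extent eqxx; congr (_ * _).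
by apply: eq_bigr => j /negPf ->.
Qed.

Lemma size_slab f w : size (slab p f w) = w * area f.
Proof. by rewrite size_map size_box prod_slab_extent. Qed.

Lemma size_strip w : size (strip p w) = w * S.
Proof.
rewrite size_flatten /shape -map_comp sumnE big_map big_enum /= big_distrr /=.
by apply: eq_bigr => f _; rewrite size_slab.
Qed.

Lemma uniq_box n : uniq (@box d n).
Proof.
rewrite map_inj_uniq ?enum_uniq // => y y' /ffunP yy'.
by apply/ffunP => i; apply: val_inj; have := yy' i; rewrite !ffunE => -[].
Qed.

Lemma boundaryE : b = size [seq x <- box e | ~~ inner p sigma x].
Proof. by rewrite size_filter. Qed.

(** The strip of width sigma lists every boundary cell, possibly several times. *)
Lemma boundary_le_strip : b <= sigma * S.
Proof.
rewrite boundaryE -size_strip; apply: uniq_leq_size; first by rewrite filter_uniq ?uniq_box.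
move=> x; rewrite mem_filter => /andP[xs xb]; have xi : inner p 0 x by rewrite inner0_box.
by apply/(mem_strip _ xi); exact: not_inner_dist.
Qed.

Lemma boundary_le_cells : b <= N.
Proof. by rewrite /b /num_boundary_cells (leq_trans (count_size _ _)) // size_box. Qed.

Let M := #|offset d sigma|.

Lemma ub_stepM t a x : ub (stepM p t a x) (4 * M + 5) (4 * M + 5).
Proof.
apply: (@ub_le _ _ (4 * M + 4).+1 (4 * M + 4).+1); try lia.
apply: ub_test.
  apply: (@ub_le _ _ (M * 4) (M * 4)); try lia.
  have := @ub_seq_sum C (offset d sigma) (enum (offset d sigma)).
  by rewrite -cardE; apply=> o _.
apply: (@ub_le _ _ (M * 2 + 1).+1 (ulg M + 1 + 1 + 1).+1); last first.
- by have := ulg_leq_pred M; lia.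
- by lia.
apply: ub_test => //.
apply: ub_bind => // ; have := @ub_pfor (offset d sigma) C 0%R (enum (offset d sigma)).
by rewrite -cardE; apply=> o _.
Qed.

Lemma ub_direct W t h a :
  ub (direct p W t h a) (h * (W * S * (4 * M + 6))) (h * (ulg (W * S) + 4 * M + 6)).
Proof.
have := @ub_seq_for nat _ (iota t h) (fun a' t' => pfor 0%R (strip p W) (stepM p t' a')) a.
rewrite size_iota; apply=> a' t' _.
have := @ub_pfor _ C 0%R (strip p W) (stepM p t' a').
rewrite size_strip => H; apply: ub_le (H _ _ (fun x _ => ub_stepM t' a' x)) _ _.
  by rewrite leq_mul2l; apply/orP; right; lia.
lia.
Qed.

Lemma lb_direct W t h a : lb (direct p W t h a) (h * (W * S)) (h * ulg (W * S)).
Proof.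
have := @lb_seq_for nat _ (iota t h) (fun a' t' => pfor 0%R (strip p W) (stepM p t' a')) a.
rewrite size_iota; apply=> a' t' _; rewrite -size_strip; exact: lb_pfor_size.
Qed.

Lemma ub_merge w h ev a :
  ub (Defs.merge p w h ev a) (w * S * 3) (ulg (w * S) + 3).
Proof.
have := @ub_pfor _ C 0%R (strip p (w - sigma * h)).
rewrite size_strip => H; apply: ub_le (H _ 2 2 _) _ _ => [x _||].
- by apply: ub_test => //; case: pickP => //= *; exact: (@ub_le _ _ 0 0).
- by rewrite leq_mul2r leq_mul2r leq_subr orbT.
- by rewrite -addnA leq_add2r leq_up_log // leq_mul2r leq_subr orbT.
Qed.

(** Padding to a power of two at most doubles each extent. *)
Lemma sum_ulg_le (n : 'I_d -> nat) : (forall i, 0 < n i) ->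
  2 ^ (\sum_i ulg (n i)) <= 2 ^ d * \prod_i n i.
Proof.
move=> n0; have -> : 2 ^ d = \prod_(i < d) 2 by rewrite prod_nat_const card_ord.
rewrite expn_sum -big_split /=; apply: leq_prod => i _.
have [n1|n1] := leqP (n i) 1; first by have := n0 i; case: (n i) n1 => [|[]].
have := up_log_gtn (ltnSn 1) n1.
have : 0 < ulg (n i) by rewrite up_log_gt0.
by case: (ulg (n i)) => // u _ /=; rewrite expnS leq_mul2l => /ltnW.
Qed.

Lemma leq_sum_ulg (n : 'I_d -> nat) : \prod_i n i <= 2 ^ (\sum_i ulg (n i)).
Proof. by rewrite expn_sum; apply: leq_prod => i _; exact: up_logP. Qed.

Lemma sum_ulg_leq (n : 'I_d -> nat) : (forall i, 0 < n i) ->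
  \sum_i ulg (n i) <= d + lg (\prod_i n i).
Proof.
move=> n0; rewrite -leq_subLR; apply: trunc_log_max => //.
have := sum_ulg_le n0; have [dK|/ltnW dK] := leqP d (\sum_i ulg (n i)).
  by rewrite -{1}(subnK dK) expnD mulnC leq_pmul2l // expn_gt0.
by move=> _; rewrite (eqP dK) prodn_gt0.
Qed.

Let FC := fft_const d sigma.
Definition free_work_const := 2 * d * 2 ^ d * (3 + FC * d.+1).
Definition free_span_const := 3 * d + 4 + FC * (d.+1 * d.+1).

(** Only the transforms across the slab are counted: in direction [f.1] the extent is w, so each
    padded cell accounts for [ulg w] operations. *)
Lemma lb_free_slabs w h a : w * S * ulg w <= cost_work (free_slabs p w h a).
Proof.
rewrite /free_slabs /= big_enum /= /S /total_area big_distrr big_distrl /=.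
apply: leq_sum => f _; apply: leqW.
set k := fun j => ulg (slab_extent p f w j).
apply: leq_trans (leq_addl _ _).
have [+ _] := lb_stencilFFT_P k p h
  (output (pfor 0%R (box (pow2 k)) (fun y => rd a (y + slab_origin p f w)%R))) f.1.
apply: leq_trans; rewrite {2}/k /slab_extent eqxx leq_mul2r; apply/orP; right.
by rewrite -prod_slab_extent; exact: leq_sum_ulg.
Qed.

Hypothesis sigma_gt0 : 0 < sigma.
Hypothesis num_cells_gt1 : 1 < num_cells p.

Lemma extent_gt0 i : 0 < e i.
Proof.
rewrite lt0n; apply/eqP => e0; move: num_cells_gt1.
by rewrite /num_cells (bigD1 i) //= -/e e0.
Qed.

(** The slab of width 1 is the face itself; it has no repetitions and, as sigma > 0, consists of
    boundary cells. *)
Lemma area_le f : area f <= b.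
Proof.
rewrite boundaryE -[area f]mul1n -size_slab; apply: uniq_leq_size.
  by rewrite map_inj_uniq ?uniq_box //; exact: addIr.
move=> _ /mapP[y /boxP yb ->]; rewrite mem_filter; apply/andP; split.
  rewrite negb_forall; apply/existsP; exists f.1.
  rewrite addvE [slab_origin _ _ _ _]ffunE eqxx /=.
  have := yb f.1; rewrite /slab_extent eqxx; have := extent_gt0 f.1.
  by rewrite /e; case: f.2; lia.
apply/boxP => j; have := yb j; rewrite addvE [slab_origin _ _ _ _]ffunE /slab_extent /e.
have := extent_gt0 j; rewrite /e.
by case: eqP => _ /=; case: f.2 => /=; lia.
Qed.

Lemma total_area_le : S <= 2 * d * b.
Proof.
rewrite /S /total_area; apply: leq_trans (leq_sum _ (fun f _ => area_le f)) _.
by rewrite sum_nat_const card_prod card_ord card_bool [d * 2]mulnC.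
Qed.

(** Some axis has extent at least 2, and the two ends of that axis through the origin are distinct
    boundary cells. *)
Lemma boundary_gt1 : 1 < b.
Proof.
have [i ei] : exists i, 1 < e i.
  apply/existsP; apply: contraLR num_cells_gt1 => /existsPn e1.
  rewrite -leqNgt /num_cells big1 // => i _.
  by have := e1 i; have := extent_gt0 i; rewrite /e; lia.
pose x0 : vec d := [ffun=> 0%R]; pose x1 := upd x0 i (e i).-1.
rewrite boundaryE; change 2 with (size [:: x0; x1]); apply: uniq_leq_size.
  rewrite /= inE andbT; apply/eqP => /ffunP /(_ i).
  by rewrite updE eqxx ffunE; lia.
have x0b : x0 \in box e.
  by apply/boxP => j; rewrite ffunE; have := extent_gt0 j; split; lia.
move=> x; rewrite !inE mem_filter => /orP[] /eqP ->.
  rewrite x0b andbT negb_forall; apply/existsP; exists i.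
  by rewrite ffunE; lia.
rewrite upd_box ?andbT; [|by []|lia].
rewrite negb_forall; apply/existsP; exists i.
by rewrite updE eqxx; move: ei; rewrite /e; lia.
Qed.

Lemma dim_gt0 : 0 < d.
Proof.
rewrite lt0n; apply/eqP => d0; move: num_cells_gt1.
by rewrite /num_cells big1 // => -[m md] _; exfalso; move: md; rewrite d0.
Qed.

Lemma ub_free_slabs w h a : 0 < w ->
  ub (free_slabs p w h a)
     (free_work_const * (w * b * (lg (w * b) + lg h + 1)))
     (free_span_const * ((lg (w * b)).+1 * (ulg (lg (w * b)).+1).+1 + lg h + 1)).
Proof.
move=> w0; set X := lg (w * b).
have b0 : 0 < b by apply: ltnW; exact: boundary_gt1.
(* [V] bounds the padded volume of every slab and [Kf] the logarithm of that volume. *)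
pose V := 2 ^ d * (w * b).
have V0 : 0 < V by rewrite !muln_gt0 expn_gt0 w0 b0.
pose Kf := d + X.
have KfX : Kf <= d.+1 * X.+1 by rewrite /Kf; nia.
have := @ub_pfor _ (vec d -> C) (fun=> 0%R) (enum {: face d}).
rewrite -cardE card_prod card_ord card_bool => H.
apply: ub_le (H _ (V * 2 + FC * (V * (Kf + lg h + 1)))
   (Kf + 2 + FC * (Kf * (ulg Kf).+1 + lg h + 1)) _) _ _ => [f _||].
- set k := fun j => ulg (slab_extent p f w j).
  have e0 j : 0 < slab_extent p f w j.
    by rewrite /slab_extent; case: ifP => // _; exact: extent_gt0.
  have KV : 2 ^ (\sum_j k j) <= V.
    apply: leq_trans (sum_ulg_le e0) _; rewrite leq_mul2l prod_slab_extent.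
    by rewrite leq_mul2l area_le !orbT.
  have KK : \sum_j k j <= Kf.
    apply: leq_trans (sum_ulg_leq e0) _; rewrite leq_add2l leq_trunc_log //.
    by rewrite prod_slab_extent leq_mul2l area_le orbT.
  apply: ub_bind => [|buf].
    have := @ub_pfor _ C 0%R (box (pow2 k)); rewrite size_box_pow2 up_expnK // => H'.
    apply: ub_le (H' _ 1 1 _) _ _ => //; first by rewrite leq_mul2r KV orbT.
    by rewrite -addnA leq_add2r.
  apply: ub_le (ub_stencilFFT_P k p h buf) _ _; rewrite leq_mul2l; apply/orP; right.
    by rewrite leq_mul // !leq_add2r.
  by rewrite !leq_add2r leq_mul // ltnS leq_up_log.
- rewrite /free_work_const /V.
  apply: (@leq_trans (d * 2 * (2 ^ d * (w * b) * ((3 + FC * d.+1) * (X + lg h + 1))))).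
    rewrite leq_mul2l -/V; apply/orP; right.
    apply: (@leq_trans (V * (3 + FC * (Kf + lg h + 1)))).
      by rewrite [V * (3 + _)]mulnDr [V * (FC * _)]mulnCA; move: (FC * _) => Y; lia.
    rewrite leq_mul2l; apply/orP; right.
    rewrite mulnDl; apply: leq_add; first by rewrite leq_pmulr // addn1.
    by rewrite -mulnA leq_mul2l; apply/orP; right; rewrite /Kf; move: (lg h) => l; nia.
  by apply: eq_leq; ring.
- have Q0 : X.+1 <= X.+1 * (ulg X.+1).+1 by rewrite leq_pmulr.
  have uK : (ulg Kf).+1 <= d.+1 * (ulg X.+1).+1.
    have := leq_trans (leq_up_log 2 KfX) (ulgM d.+1 X.+1).
    move: (ulg_leq_pred d.+1) => /=; clear.
    move: (ulg Kf) (ulg d.+1) (ulg X.+1) => u1 u2 u3 h1 h2.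
    by rewrite mulSn mulnS; lia.
  have KuK : Kf * (ulg Kf).+1 <= d.+1 * d.+1 * (X.+1 * (ulg X.+1).+1).
    by apply: leq_trans (leq_mul KfX uK) _; apply: eq_leq; ring.
  have u2d := ulg_leq_pred (d * 2).
  rewrite /free_span_const; move: (X.+1 * _) Q0 KuK => Q Q0 KuK.
  apply: (@leq_trans ((3 * d + 4) * (Q + lg h + 1) + FC * (d.+1 * d.+1 * (Q + lg h + 1)))).
    rewrite addnA; apply: leq_add.
      apply: (@leq_trans (3 * d + 4 + Q)); first by rewrite /Kf; lia.
      rewrite -[Q + _ + 1]addnA mulnDr addnC leq_add //.
        by rewrite leq_pmull // addn4.
      by rewrite leq_pmulr // addn1.
    rewrite leq_mul2l; apply/orP; right.
    by rewrite -!addnA mulnDr leq_add // leq_pmull // muln_gt0.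
  by apply: eq_leq; ring.
Qed.

End Costs.

(** * The recursion *)

Local Open Scope nat_scope.

Section RecursionCosts.

Variables (C : numClosedFieldType) (d sigma : nat) (p : stencil_problem C d sigma).
Hypothesis sigma_gt0 : 0 < sigma.
Hypothesis num_cells_gt1 : 1 < num_cells p.
Implicit Types (a : vec d -> C).

Let b := num_boundary_cells p.
Let S := total_area p.
Let M := #|offset d sigma|.
Let b_gt1 : 1 < b := boundary_gt1 sigma_gt0 num_cells_gt1.
Let bS : b <= sigma * S := boundary_le_strip p.
Let Sb : S <= 2 * d * b := total_area_le sigma_gt0 num_cells_gt1.

Definition free_work w h := free_work_const d sigma * (w * b * (lg (w * b) + lg h + 1)).
Definition free_span w h :=
  free_span_const d sigma * ((lg (w * b)).+1 * (ulg (lg (w * b)).+1).+1 + lg h + 1).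

Lemma ub_free_slabs_le w w' h h' a : 0 < w <= w' -> h <= h' ->
  ub (free_slabs p w h a) (free_work w' h') (free_span w' h').
Proof.
move=> /andP[w0 ww'] hh'.
have wbL : lg (w * b) <= lg (w' * b) by rewrite leq_trunc_log // leq_mul2r ww' orbT.
apply: ub_le (ub_free_slabs sigma_gt0 num_cells_gt1 h a w0) _ _;
  rewrite leq_mul2l; apply/orP; right.
  by rewrite leq_mul ?leq_mul2r ?ww' ?orbT // leq_add2r leq_add // leq_trunc_log.
rewrite leq_add2r leq_add ?leq_trunc_log // leq_mul // ltnS leq_up_log //.
Qed.

Lemma ub_merge_le w w' h ev a : w <= w' ->
  ub (Defs.merge p w h ev a) (w' * S * 3) (ulg (w' * S) + 3).
Proof.
move=> ww'; apply: ub_le (ub_merge _ _ _ _ _) _ _.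
  by rewrite leq_mul2r leq_mul2r ww' !orbT.
by rewrite leq_add2r leq_up_log // leq_mul2r ww' orbT.
Qed.

(** Both halves are charged at the width and step count of the whole call; the final 3 is for the
    test and the two forks. *)
Definition node_work T := 2 * (free_work (2 * sigma * T) T + 2 * sigma * T * S * 3) + 3.
Definition node_span T :=
  2 * (free_span (2 * sigma * T) T + (ulg (2 * sigma * T * S) + 3)) + 3.

(** [FW] and [FS] may be any supersolutions of the recurrences. In the span, the maximum at a fork
    is replaced by a sum, so that the slab transforms count as overhead. The range is capped by
    [Tmax] because the work bound uses a logarithmic factor fixed at the top call. *)
Lemma ub_recursive_boundary (FW FS : nat -> nat) tau Tmax : 0 < tau ->
  (forall T, 0 < T <= tau -> T <= Tmax ->
     (T * (2 * sigma * tau * S * (4 * M + 6))).+1 <= FW T /\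
     (T * (ulg (2 * sigma * tau * S) + 4 * M + 6)).+1 <= FS T) ->
  (forall T, tau < T <= Tmax ->
     FW T./2 + FW (T - T./2) + node_work T <= FW T /\
     FS T./2 + FS (T - T./2) + node_span T <= FS T) ->
  forall fuel T t a, 0 < T <= fuel -> T <= Tmax ->
    ub (recursive_boundary p fuel tau T t a) (FW T) (FS T).
Proof.
move=> tau0 leaf node; elim=> [|fuel IH] T t a; first by case: T.
move=> /andP[T0 Tf] Tm; rewrite recursive_boundaryS.
have [Tt|tT] := leqP T tau.
  have [lW lS] : _ /\ _ := leaf T (introT andP (conj T0 Tt)) Tm.
  by apply: ub_le lW lS; apply: ub_testT; exact: ub_direct.
have T1 : 1 < T by apply: leq_ltn_trans tT.
have [h1T h2T hE _ _] := half_bounds T1.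
have [nW nS] : _ /\ _ := node T (introT andP (conj tT Tm)).
set h1 := T./2 in nW nS h1T h2T hE *; set h2 := T - h1 in nW nS h2T hE *.
set w1 := 2 * sigma * T; set w2 := w1 - sigma * h1.
have w1p : 0 < w1 <= w1 by rewrite leqnn andbT !muln_gt0 sigma_gt0 T0.
have w2p : 0 < w2 <= w1.
  rewrite leq_subr andbT subn_gt0 /w1 [2 * _]mulnC -mulnA ltn_pmul2l //.
  by move: h1T; lia.
pose WF := free_work w1 T; pose SF := free_span w1 T.
apply: (@ub_le _ _ (((WF + FW h1).+1 + (w1 * S * 3 + ((WF + FW h2).+1 + w1 * S * 3)))).+1
  ((maxn SF (FS h1)).+1 + (ulg (w1 * S) + 3 + ((maxn SF (FS h2)).+1 + (ulg (w1 * S) + 3)))).+1).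
- apply: ub_testF.
  apply: ub_bind => [|r1].
    by apply: ub_par; [apply: ub_free_slabs_le => //; lia | apply: IH; lia].
  apply: ub_bind => [|a1]; first exact: ub_merge_le.
  apply: ub_bind => [|r2]; last by apply: ub_merge_le; case/andP: w2p.
  by apply: ub_par; [apply: ub_free_slabs_le => //; lia | apply: IH; lia].
- by apply: leq_trans nW; rewrite /node_work -/w1 -/WF; lia.
- by apply: leq_trans nS; rewrite /node_span -/w1 -/SF; lia.
Qed.

Lemma leaf_work_le T tau : 0 < T -> 0 < tau ->
  (T * (2 * sigma * tau * S * (4 * M + 6))).+1
    <= (4 * sigma * d * (4 * M + 6) + 1) * (b * T * tau).
Proof.
move=> T0 tau0; rewrite mulnDl mul1n -addn1; apply: leq_add.
  apply: (@leq_trans (T * (2 * sigma * tau * (2 * d * b) * (4 * M + 6)))).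
    by rewrite leq_mul2l leq_mul2r leq_mul2l Sb !orbT.
  by apply: eq_leq; ring.
by rewrite !muln_gt0 T0 tau0 ltnW.
Qed.

Lemma node_work_le T L : 0 < T -> lg (2 * sigma * T * b) + lg T + 1 <= L ->
  node_work T <= (4 * sigma * free_work_const d sigma + 24 * sigma * d + 3) * (b * T * L).
Proof.
move=> T0 HL; have L0 : 0 < L by apply: leq_trans HL; rewrite addn1.
have b0 : 0 < b by exact: ltnW.
rewrite /node_work /free_work; move: (free_work_const d sigma) => fw.
apply: (@leq_trans (2 * (fw * (2 * sigma * T * b * L) + 2 * sigma * T * (2 * d * b) * 3)
   + 3 * (b * T * L))).
  apply: leq_add; last by rewrite leq_pmulr // !muln_gt0 b0 T0.
  rewrite leq_mul2l /=; apply: leq_add; first by rewrite !leq_mul2l HL !orbT.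
  by rewrite leq_mul2r leq_mul2l Sb !orbT.
apply: (@leq_trans (4 * sigma * fw * (b * T * L) + 24 * sigma * d * (b * T * L) + 3 * (b * T * L))).
  rewrite leq_add2r mulnDr; apply: leq_add; first by apply: eq_leq; ring.
  apply: (@leq_trans (24 * sigma * d * (b * T))); first by apply: eq_leq; ring.
  by rewrite leq_mul2l [b * T * L]mulnC leq_pmull ?orbT.
by apply: eq_leq; ring.
Qed.

Let beta := (lg b).+1.

Lemma ulg_2sigma_S w : ulg (2 * sigma * w * S) <= 4 * sigma * d + ulg w + beta.
Proof.
apply: (@leq_trans (ulg (4 * sigma * d * (w * b)))).
  apply: leq_up_log; apply: (@leq_trans (2 * sigma * w * (2 * d * b))).
    by rewrite leq_mul2l Sb orbT.
  by apply: eq_leq; ring.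
apply: leq_trans (ulgM _ _) _; rewrite -addnA; apply: leq_add.
  exact: leq_trans (ulg_leq_pred _) (leq_pred _).
by apply: leq_trans (ulgM _ _) _; rewrite leq_add2l; exact: ulg_leq_lg.
Qed.

Lemma leaf_span_le T tau : 0 < T -> ulg tau <= 2 * beta ->
  (T * (ulg (2 * sigma * tau * S) + 4 * M + 6)).+1
    <= (4 * sigma * d + 4 * M + 10) * (beta * T).
Proof.
move=> T0 utau; have := ulg_2sigma_S tau.
set u := ulg _ => hu.
apply: (@leq_trans (T * (u + 4 * M + 7))).
  have -> : u + 4 * M + 7 = u + 4 * M + 6 + 1 by lia.
  by rewrite [leqRHS]mulnDr muln1 -addn1 leq_add2l.
rewrite mulnA [_ * T]mulnC leq_mul2l; apply/orP; right.
apply: (@leq_trans (4 * sigma * d + 4 * M + 7 + 3 * beta)); first by lia.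
have : 0 < beta by [].
by move: beta (4 * sigma * d + 4 * M) => B Y; nia.
Qed.

Definition node_span_const := 2 * (free_span_const d sigma * ((2 * sigma + 3) * (2 * sigma + 4) + 1)
  + (4 * sigma * d + 5)) + 3.

(** The assumption beta <= T turns the iterated logarithm of the slab volume into O(log T): that
    volume has logarithm O(X * beta), whose own logarithm is O(X). *)
Lemma node_span_le T : 0 < T -> beta <= T ->
  node_span T <= node_span_const * (beta * ((lg T).+1 * (lg T).+1)).
Proof.
move=> T0 bT; set X := (lg T).+1.
have b0 : 0 < b by exact: ltnW.
have uT : ulg T <= X by exact: ulg_leq_lg.
have ubeta : ulg beta <= X by apply: leq_trans uT; rewrite leq_up_log.
have P0 : 0 < beta * (X * X) by [].
have XP : X <= beta * (X * X) by rewrite mulnCA leq_pmulr // muln_gt0.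
have betaP : beta <= beta * (X * X) by rewrite leq_pmulr.
have Lw : (lg (2 * sigma * T * b)).+1 <= (2 * sigma + 3) * (X * beta).
  apply: (@leq_trans (2 * sigma + lg T + lg b + 3)).
    have := lgM (2 * sigma * T) b; have := lgM (2 * sigma) T; have := lg_leq (2 * sigma).
    lia.
  by rewrite /X /beta; move: (lg T) (lg b) => x y; nia.
have uLw : (ulg (lg (2 * sigma * T * b)).+1).+1 <= (2 * sigma + 4) * X.
  have := leq_trans (leq_up_log 2 Lw) (ulgM _ _); have := ulgM X beta.
  have := ulg_leq_pred (2 * sigma + 3); have := ulg_leq_pred X.
  move=> uX uS uXb uL; apply: (@leq_trans (2 * sigma + 2 + 2 * X)).
    by move: uX; rewrite /= => uX; lia.
  have : sigma <= sigma * X by rewrite leq_pmulr.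
  by rewrite mulnDl -mulnA; lia.
have LuL := leq_mul Lw uLw.
have uS := ulg_2sigma_S T.
rewrite /node_span /free_span /node_span_const.
set Q := _.+1 * _ in LuL *; set P := beta * (X * X).
have QP : Q <= (2 * sigma + 3) * (2 * sigma + 4) * P.
  by apply: leq_trans LuL _; apply: eq_leq; rewrite /P; ring.
rewrite -/P in P0 XP betaP; rewrite mulnDl; apply: leq_add; last by rewrite leq_pmulr.
rewrite -[leqRHS]mulnA leq_mul2l /= [leqRHS]mulnDl; apply: leq_add.
  rewrite -[leqRHS]mulnA leq_mul2l; apply/orP; right.
  by rewrite -addnA [leqRHS]mulnDl leq_add // mul1n addn1.
apply: (@leq_trans (4 * sigma * d + P + P + 3)); first by lia.
by rewrite mulnDl; have := leq_pmulr (4 * sigma * d) P0; move: (4 * sigma * d * P) => *; lia.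
Qed.

(** The quadratic solution of g (l+1) + (l+2)^2 = 2 * g l, the recurrence of the accumulated
    overhead when T doubles. *)
Let g l := l * l + 6 * l + 11.

Lemma g_le l n : 2 ^ l <= n -> g l <= 18 * n.
Proof.
move=> ln; apply: (@leq_trans (18 * 2 ^ l)); last by rewrite leq_mul2l ln.
elim: l {n ln} => // l IH; rewrite expnS mulnCA.
by move: (18 * _) IH; rewrite /g => Y; nia.
Qed.

Lemma g_half l1 l2 : l1 <= l2 -> g l1.+1 + l1.+2 * l1.+2 <= g l1 + g l2.
Proof. by move=> l12; have := leq_mul l12 l12; rewrite /g; nia. Qed.

(** As g (lg T) <= 18 * T, the coefficient 19 places the potential between T and 19 * T. *)
Definition span_potential T := 19 * T - g (lg T).

Lemma leq_span_potential T : 0 < T -> T <= span_potential T.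
Proof.
move=> T0; have := g_le (trunc_logP (ltnSn 1) T0); rewrite /span_potential; lia.
Qed.

Lemma span_potential_half T : 1 < T ->
  span_potential T./2 + span_potential (T - T./2) + (lg T).+1 * (lg T).+1
    <= span_potential T.
Proof.
move=> T1; have [/andP[h1 _] /andP[h2 _] hE lE [l12 _ _]] := half_bounds T1.
have T0 : 0 < T by lia.
have := g_half l12; rewrite -lE => Hg.
have := g_le (trunc_logP (ltnSn 1) T0).
have := g_le (trunc_logP (ltnSn 1) h1); have := g_le (trunc_logP (ltnSn 1) h2).
rewrite /span_potential; move: (g _) (g _) (g _) (_.+1 * _) Hg => *; lia.
Qed.

Definition rec_work_const := 4 * sigma * free_work_const d sigma + 24 * sigma * d + 3
  + (4 * sigma * d * (4 * M + 6) + 1).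

Definition rec_span_const := node_span_const + (4 * sigma * d + 4 * M + 10).

Lemma ub_recursive_boundary_cutoff fuel tau T t a :
  beta <= tau -> ulg tau <= 2 * beta -> 0 < T <= fuel ->
  ub (recursive_boundary p fuel tau T t a)
    (rec_work_const * (b * T * (tau + (lg (2 * sigma * T * b) + lg T + 1) * ulg T)))
    (19 * rec_span_const * (beta * T)).
Proof.
move=> btau utau Tf; set L := _ + 1.
have tau0 : 0 < tau by apply: leq_trans btau.
have L0 : 0 < L by rewrite /L addn1.
have b0 : 0 < b by exact: ltnW.
pose A := 4 * sigma * d * (4 * M + 6) + 1.
pose B := 4 * sigma * free_work_const d sigma + 24 * sigma * d + 3.
(* The first term is the direct steps, linear in h; in the second, [ulg h] counts the levels and [L]
   is the logarithmic factor of the top call. *)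
pose FW h := A * (b * h * tau) + B * (b * h * L * ulg h).
pose FS h := rec_span_const * (beta * span_potential h).
apply: (@ub_le _ _ (FW T) (FS T)); last first.
- by rewrite /FS [19 * _]mulnC -mulnA [19 * _]mulnCA !leq_mul2l leq_subr !orbT.
- rewrite /FW /rec_work_const -/A -/B; clear FW; move: A B => A' B'.
  rewrite (_ : (B' + A') * _ = A' * (b * T * tau) + B' * (b * T * L * ulg T)
    + (A' * (b * T * (L * ulg T)) + B' * (b * T * tau))); last by ring.
  exact: leq_addr.
apply: (ub_recursive_boundary (Tmax := T)) => // h /andP[h0 hb].
  move=> hT; split.
    by apply: leq_trans (leaf_work_le h0 tau0) _; exact: leq_addr.
  apply: leq_trans (leaf_span_le h0 utau) _.
  by apply: leq_mul; [exact: leq_addl | rewrite leq_mul2l leq_span_potential ?orbT].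
have h1 : 1 < h by apply: leq_ltn_trans h0.
have h1p : 0 < h by exact: ltnW.
have [h1T h2T hE lE [l12 u1 u2]] := half_bounds h1.
split.
  have HL : lg (2 * sigma * h * b) + lg h + 1 <= L.
    by rewrite leq_add2r leq_add // leq_trunc_log // leq_mul2r leq_mul2l hb !orbT.
  have := node_work_le h1p HL; rewrite -/B => HB.
  apply: leq_trans (leq_add (leqnn _) HB) _; rewrite /FW.
  have H1 : h./2 * (ulg h./2).+1 <= h./2 * ulg h by rewrite leq_mul2l u1 orbT.
  have H2 : (h - h./2) * (ulg (h - h./2)).+1 <= (h - h./2) * ulg h by rewrite leq_mul2l u2 orbT.
  have H3 : h./2 * ulg h + (h - h./2) * ulg h = h * ulg h by rewrite -mulnDl hE.
  apply: (@leq_trans (A * (b * tau) * (h./2 + (h - h./2)) +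
     B * (b * L) * (h./2 * (ulg h./2).+1 + (h - h./2) * (ulg (h - h./2)).+1))).
    rewrite -[X in B * (b * X * L)]hE; apply: eq_leq.
    by move: (h./2) (h - h./2) => x y; ring.
  rewrite hE; apply: leq_add; first by apply: eq_leq; ring.
  apply: (@leq_trans (B * (b * L) * (h * ulg h))); last by apply: eq_leq; ring.
  by rewrite leq_mul2l -H3 leq_add ?orbT.
have := node_span_le h1p (leq_trans btau (ltnW h0)) => HS.
apply: leq_trans (leq_add (leqnn _) HS) _; rewrite /FS.
apply: (@leq_trans (rec_span_const * (beta * (span_potential h./2
    + span_potential (h - h./2) + (lg h).+1 * (lg h).+1)))).
  rewrite !mulnDr leq_add2l leq_mul2r; apply/orP; right.
  exact: leq_addr.
by rewrite !leq_mul2l span_potential_half ?orbT.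
Qed.

(** Every leaf runs its steps on a strip of width 2 * sigma * tau, however few they are, and the
    leaves perform T steps in total, one after the other. *)
Lemma lb_recursive_boundary fuel tau T t a : 0 < tau -> 0 < T <= fuel ->
  lb (recursive_boundary p fuel tau T t a) (2 * b * T * tau) (T * ulg b).
Proof.
move=> tau0; elim: fuel T t a => [|fuel IH] T t a; first by case: T.
move=> /andP[T0 Tf]; rewrite recursive_boundaryS.
have [Tt|tT] := leqP T tau.
  apply: lb_testT; apply: lb_le (lb_direct p (2 * sigma * tau) t T a) _ _.
    apply: (@leq_trans (2 * (sigma * S) * T * tau)); last by apply: eq_leq; ring.
    by rewrite !leq_mul2r leq_mul2l bS !orbT.
  rewrite leq_mul2l leq_up_log ?orbT //; apply: leq_trans bS _.
  by rewrite leq_mul2r -mulnA mulnCA leq_pmulr ?orbT // muln_gt0.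
have T1 : 1 < T by apply: leq_ltn_trans tT.
have [h1T h2T hE _ _] := half_bounds T1.
apply: lb_testF.
apply: (@lb_le _ _ (0 + 2 * b * T./2 * tau + (0 + (0 + 2 * b * (T - T./2) * tau + 0)))
  (maxn 0 (T./2 * ulg b) + (0 + (maxn 0 ((T - T./2) * ulg b) + 0)))).
- apply: lb_bind => [|r1]; first by apply: lb_par; [exact: lb0 | apply: IH; lia].
  apply: lb_bind => [|a1]; first exact: lb0.
  apply: lb_bind => [|r2]; last exact: lb0.
  by apply: lb_par; [exact: lb0 | apply: IH; lia].
- by rewrite !add0n addn0 -mulnDl -mulnDr hE.
- by rewrite !max0n add0n addn0 -mulnDl hE.
Qed.

(* The work of the transforms in the calls with at least [m] time steps. *)
Lemma lb_recursive_boundary_levels fuel tau m T t a : 0 < tau <= m -> m <= T <= fuel ->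
  2 * b * T * lg m * (lg T - lg m - 1) <= cost_work (recursive_boundary p fuel tau T t a).
Proof.
move=> /andP[tau0 taum]; elim: fuel T t a => [|fuel IH] T t a; first by lia.
move=> /andP[mT Tf]; have [->|lT] := posnP (lg T - lg m - 1); first by rewrite muln0.
(* A positive level count leaves room for one more halving: both halves still have at least m
   steps. *)
have m2T : m.*2 <= T.
  rewrite leqNgt; apply/negP => /ltnW /(leq_trunc_log 2).
  by rewrite trunc_log2_double; lia.
have T1 : 1 < T by lia.
have [h1T h2T hE lE [l12 _ _]] := half_bounds T1.
rewrite recursive_boundaryS.
have -> : (T <= tau) = false by lia.
set h1 := T./2 in h1T h2T hE lE l12 *; set h2 := T - h1 in h2T hE l12 *.
have h1m : m <= h1 by rewrite /h1; lia.
have [+ _] : lb (recursive_boundary p fuel.+1 tau T t a)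
   (2 * sigma * T * S * ulg (2 * sigma * T) + 2 * b * h1 * lg m * (lg h1 - lg m - 1)
   + (0 + (0 + 2 * b * h2 * lg m * (lg h2 - lg m - 1) + 0))) 0.
  rewrite recursive_boundaryS; have -> : (T <= tau) = false by lia.
  apply: lb_testF; rewrite -[X in lb _ _ X]/(0 + (0 + (0 + 0))).
  have IH' h t' a' : m <= h <= fuel -> lb (recursive_boundary p fuel tau h t' a')
     (2 * b * h * lg m * (lg h - lg m - 1)) 0 by move=> /IH; split.
  apply: lb_bind => [|r1].
    rewrite -[X in lb _ _ X]/(maxn 0 0); apply: lb_par; last by apply: IH'; lia.
    by split=> //; exact: lb_free_slabs.
  apply: lb_bind => [|a1]; first exact: lb0.
  apply: lb_bind => [|r2]; last exact: lb0.
  rewrite -[X in lb _ X]add0n -[X in lb _ _ X]/(maxn 0 0).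
  by apply: lb_par; [exact: lb0 | apply: IH'; lia].
rewrite recursive_boundaryS; have -> : (T <= tau) = false by lia.
apply: leq_trans.
have HW : 2 * b * T * lg m <= 2 * sigma * T * S * ulg (2 * sigma * T).
  apply: leq_mul.
    apply: (@leq_trans (2 * (sigma * S) * T)); last by apply: eq_leq; ring.
    by rewrite leq_mul2r leq_mul2l bS !orbT.
  apply: leq_trans (lg_leq_ulg m) _; apply: leq_up_log; apply: leq_trans mT _.
  by rewrite leq_pmull // muln_gt0.
rewrite !add0n addn0.
(* One level is paid by the first slab transforms of this call, the other k by the two recursive
   calls. *)
have [k kE] : exists k, lg T - lg m - 1 = k.+1 by exists (lg T - lg m - 1).-1; lia.
have k1 : k <= lg h1 - lg m - 1 by lia.
have k2 : k <= lg h2 - lg m - 1 by lia.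
rewrite kE mulnS -addnA; apply: leq_add HW _.
apply: (@leq_trans (2 * b * h1 * lg m * k + 2 * b * h2 * lg m * k)).
  by rewrite -!mulnDl -mulnDr hE.
by apply: leq_add; rewrite leq_mul2l ?k1 ?k2 orbT.
Qed.

End RecursionCosts.

(** * The whole algorithm *)

Local Open Scope nat_scope.

Section AlgorithmCosts.

Variables (C : numClosedFieldType) (d sigma : nat) (p : stencil_problem C d sigma).
Hypothesis sigma_gt0 : 0 < sigma.
Hypothesis num_cells_gt1 : 1 < num_cells p.

Let b := num_boundary_cells p.
Let N := num_cells p.
Let b_gt1 : 1 < b := boundary_gt1 sigma_gt0 num_cells_gt1.

Let k i := ulg (extent p i).
Let K := \sum_i k i.

Lemma cutoff_ge T : (lg b).+1 <= cutoff p T.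
Proof. exact: leq_pmulr. Qed.

(** The minimum with b in the cut-off keeps its logarithm O(log b) however large T is. *)
Lemma ulg_cutoff T : ulg (cutoff p T) <= 2 * (lg b).+1.
Proof.
apply: leq_trans (ulgM _ _) _; rewrite mul2n -addnn; apply: leq_add.
  by apply: leq_trans (ulg_leq_pred _) _; rewrite /= leqW.
apply: leq_trans (ulg_leq_pred _) _; rewrite /= leqW // leq_trunc_log //.
exact: geq_minr.
Qed.

Lemma leq_cells_exp : N <= 2 ^ K.
Proof. exact: leq_sum_ulg. Qed.

Lemma exp_leq_cells : 2 ^ K <= 2 ^ d * N.
Proof. by apply: sum_ulg_le; exact: extent_gt0. Qed.

Lemma sum_ulg_extent : K <= d + lg N.
Proof. by apply: sum_ulg_leq; exact: extent_gt0. Qed.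

Let lgN : 0 < lg N. Proof. by rewrite trunc_log_gt0. Qed.

Definition alg_work_const := fft_const d sigma * 2 ^ d * (d + 2) + 6 + rec_work_const d sigma.

Definition alg_span_const :=
  10 + fft_const d sigma * (d.+1 * d.+1 + 1) + 19 * rec_span_const d sigma.

Lemma ub_stencilFFT_A T : 0 < T ->
  ub (stencilFFT_A p T)
    (alg_work_const * (N * (lg N + lg T) +
       b * T * (cutoff p T + (lg (2 * sigma * T * b) + lg T + 1) * ulg T)))
    (alg_span_const * ((lg b).+1 * T + lg N * (ulg (lg N)).+1)).
Proof.
move=> T0; set R := b * T * _; pose FC := fft_const d sigma.
have N0 : 0 < N by apply: ltnW.
have NN : N <= N * lg N by rewrite leq_pmulr.
apply: (@ub_le _ _ (N * 2 + ((FC * (2 ^ K * (K + lg T + 1)) + rec_work_const d sigma * R).+1 + N * 3))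
  (ulg N + 1 + 1 + ((maxn (FC * (K * (ulg K).+1 + lg T + 1))
     (19 * rec_span_const d sigma * ((lg b).+1 * T))).+1 + (ulg N + 1 + 2)))).
- apply: ub_bind => [|a].
    have := @ub_pfor _ C 0%R (box (extent p)); rewrite size_box -/(num_cells p) -/N.
    by apply=> x _.
  apply: ub_bind => [|r].
    apply: ub_par; first exact: ub_stencilFFT_P.
    apply: ub_recursive_boundary_cutoff => //; first exact: cutoff_ge.
      exact: ulg_cutoff.
    by rewrite T0 /=.
  have := @ub_pfor _ C 0%R (box (extent p)); rewrite size_box -/(num_cells p) -/N.
  by apply=> x _; apply: ub_test.
- rewrite /alg_work_const -/FC mulnDl.
  apply: (@leq_trans ((FC * 2 ^ d * (d + 2) + 6) * (N * (lg N + lg T))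
     + rec_work_const d sigma * R)).
    have H : FC * (2 ^ K * (K + lg T + 1)) <= FC * 2 ^ d * (d + 2) * (N * (lg N + lg T)).
      apply: (@leq_trans (FC * (2 ^ d * N * ((d + 2) * (lg N + lg T))))).
        rewrite leq_mul2l leq_mul ?orbT ?exp_leq_cells //.
        have := sum_ulg_extent; have := lgN; move: K (lg N) (lg T) => x y z; nia.
      by apply: eq_leq; ring.
    have Z : N <= N * (lg N + lg T) by rewrite leq_pmulr // addn_gt0 lgN.
    rewrite mulnDl; move: H Z; set x := FC * (2 ^ K * _); set y := FC * _ * _ * _.
    by set r := _ * R; move: (N * (_ + _)) => z; lia.
  apply: leq_add; rewrite leq_mul2l; apply/orP; right; first exact: leq_addr.
  exact: leq_addl.
- rewrite /alg_span_const -/FC.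
  set P := lg N * _; set Q := _.+1 * T.
  have PN : lg N <= P by rewrite leq_pmulr.
  (* The repeated squaring in the periodic solver has depth O(log T), which the boundary term
     absorbs. *)
  have TQ : (lg T).+1 <= Q.
    apply: (@leq_trans T); last by rewrite leq_pmull.
    by have := lg_leq_ulg T; have := ulg_leq_pred T; lia.
  have KN : K <= d.+1 * lg N.
    by apply: leq_trans sum_ulg_extent _; rewrite mulSn addnC leq_add2l leq_pmulr.
  have uK : (ulg K).+1 <= d.+1 * (ulg (lg N)).+1.
    have := leq_trans (leq_up_log 2 KN) (ulgM d.+1 (lg N)).
    move: (ulg_leq_pred d.+1) => /=; move: (ulg K) (ulg d.+1) (ulg (lg N)) => x y z h1 h2.
    by rewrite mulSn mulnS; lia.
  have KuK : K * (ulg K).+1 <= d.+1 * d.+1 * P.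
    by apply: leq_trans (leq_mul KN uK) _; apply: eq_leq; rewrite /P; ring.
  have uN : ulg N <= lg N + 1 by rewrite addn1; exact: ulg_leq_lg.
  have HF : FC * (K * (ulg K).+1 + lg T + 1) <= FC * (d.+1 * d.+1 + 1) * (Q + P).
    rewrite -mulnA leq_mul2l; apply/orP; right.
    apply: (@leq_trans (d.+1 * d.+1 * P + Q)); first by rewrite -addnA leq_add // addn1.
    by rewrite mulnDl mul1n mulnDr; lia.
  have HR : 19 * rec_span_const d sigma * Q <= 19 * rec_span_const d sigma * (Q + P).
    by rewrite leq_mul2l leq_addr orbT.
  rewrite [_ * (Q + P)]mulnDl [(10 + _) * _]mulnDl.
  apply: leq_trans (leq_add (leq_add (leqnn (10 * (Q + P))) HF) HR).
  move: (FC * (_ + _ + _)) (_ * Q) => x u.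
  have : maxn x u <= x + u by rewrite geq_max leq_addr leq_addl.
  clear - PN TQ uN lgN; move: (maxn x u) (ulg N) PN TQ uN => m n PN TQ uN.
  by move: (lg T) (lg N) lgN PN TQ uN => t l; lia.
Qed.

Lemma lb_stencilFFT_A T i : 0 < T ->
  lb (stencilFFT_A p T) (2 ^ K * k i + 2 * b * T * cutoff p T)
     (maxn (K + k i * lg (k i)) (T * ulg b)).
Proof.
move=> T0; apply: (@lb_le _ _ (0 + (2 ^ K * k i + 2 * b * T * cutoff p T + 0))
   (0 + (maxn (K + k i * lg (k i)) (T * ulg b) + 0))); [|lia|lia].
apply: lb_bind => [|a]; first exact: lb0.
apply: lb_bind => [|r]; last exact: lb0.
apply: lb_par; first exact: lb_stencilFFT_P.
by apply: lb_recursive_boundary => //; rewrite ?T0 //=; apply: leq_trans (cutoff_ge T).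
Qed.

Lemma stencilFFT_A_work_levels T m : 0 < T -> cutoff p T <= m <= T ->
  2 * b * T * lg m * (lg T - lg m - 1) <= cost_work (stencilFFT_A p T).
Proof.
move=> T0 /andP[cm mT].
set v := 2 * b * T * _ * _.
suff [] : lb (stencilFFT_A p T) (0 + (0 + v + 0)) (0 + (maxn 0 0 + 0)) by rewrite add0n addn0.
apply: lb_bind => [|a]; first exact: lb0.
apply: lb_bind => [|r]; last exact: lb0.
apply: lb_par; first exact: lb0.
split=> //; apply: lb_recursive_boundary_levels => //; last by rewrite mT leqnn.
Qed.

(* [l] is the logarithm of the largest padded extent. *)
Lemma stencilFFT_A_lower T : 0 < T ->
  [/\ ulg N * N <= d * cost_work (stencilFFT_A p T),
      2 * b * T * cutoff p T <= cost_work (stencilFFT_A p T),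
      T * ulg b <= cost_span (stencilFFT_A p T) &
      exists l, [/\ ulg N <= d * l, l <= cost_span (stencilFFT_A p T) &
        l * lg l <= cost_span (stencilFFT_A p T)]].
Proof.
move=> T0; have d0 : 0 < d := dim_gt0 num_cells_gt1.
(* A direction of largest padded extent carries at least the fraction 1/d of the total logarithm
   K. *)
pose i := [arg max_(j > Ordinal d0) k j].
have ki j : k j <= k i by rewrite /i; case: arg_maxnP => // j' _; apply.
have NK : ulg N <= K by apply: up_log_min => //; exact: leq_cells_exp.
have Kd : K <= d * k i.
  by rewrite -[d in leqRHS]card_ord -sum_nat_const; apply: leq_sum => j _.
have [lW lS] := lb_stencilFFT_A i T0.
split.
- apply: (@leq_trans (d * (2 ^ K * k i))); last first.
    by rewrite leq_mul2l (leq_trans _ lW) ?orbT // leq_addr.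
  rewrite mulnCA mulnC; apply: leq_mul; first exact: leq_cells_exp.
  exact: leq_trans Kd.
- by apply: leq_trans lW; rewrite leq_addl.
- by apply: leq_trans lS; rewrite leq_maxr.
exists (k i); split; first exact: leq_trans Kd.
- apply: leq_trans lS; apply: leq_trans (leq_maxl _ _).
  by apply: leq_trans (leq_addr _ _); exact: leq_exp_sum.
- by apply: leq_trans lS; apply: leq_trans (leq_maxl _ _); rewrite leq_addl.
Qed.

End AlgorithmCosts.

(** * Asymptotic bounds *)

Local Open Scope nat_scope.

Section WorkInLogs.

Variables (C : numClosedFieldType) (d sigma : nat) (p : stencil_problem C d sigma).
Hypothesis sigma_gt0 : 0 < sigma.
Hypothesis num_cells_gt1 : 1 < num_cells p.

Let b := num_boundary_cells p.
Let N := num_cells p.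
Let b_gt1 : 1 < b := boundary_gt1 sigma_gt0 num_cells_gt1.
Let b_le_N : b <= N := boundary_le_cells p.

Let lgb : 0 < lg b. Proof. by rewrite trunc_log_gt0. Qed.

Lemma stencilFFT_A_work_le T : 0 < T ->
  cost_work (stencilFFT_A p T) <= alg_work_const d sigma * (4 * sigma + 16) *
    (b * T * ((lg b + lg T) * lg T) + N * lg N).
Proof.
move=> T0; have [H _] := ub_stencilFFT_A sigma_gt0 num_cells_gt1 T0.
apply: leq_trans H _; rewrite -[leqRHS]mulnA leq_mul2l; apply/orP; right.
rewrite -/b -/N; set X := b * T * ((lg b + lg T) * lg T); set Y := N * lg N.
have bY : b * lg b <= Y by rewrite leq_mul // leq_trunc_log.
(* For T = 1 the boundary term vanishes because log T = 0, and the direct step of work O(b log b) is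
   absorbed by N log N. *)
have [T1|T1] := leqP T 1.
  have -> : T = 1 by lia.
  rewrite /cutoff trunc_log1 up_log1 muln0 !addn0 !muln1.
  have -> : lg (minn 1 (num_boundary_cells p)) = 0.
    by rewrite (minn_idPl _) ?trunc_log1 // ltnW.
  rewrite muln1 -/b; apply: (@leq_trans (Y + 2 * (b * lg b))).
    rewrite -/Y leq_add2l; apply: (@leq_trans (b * (2 * lg b))); last by rewrite mulnCA.
    by rewrite leq_mul2l; apply/orP; right; lia.
  by rewrite /Y; move: bY; rewrite /Y; move: (N * _) (b * _) => y z; nia.
have lgT : 0 < lg T by rewrite trunc_log_gt0.
(* The powers of the eigenvalues cost N log T: this is below N log N if T <= N, and below the
   boundary term otherwise. *)
have NT : N * lg T <= X + Y.
  have [TN|NT] := leqP T N.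
    by apply: leq_trans (leq_addl _ _); rewrite leq_mul2l leq_trunc_log ?orbT.
  apply: leq_trans (leq_addr _ _); rewrite /X mulnA leq_mul //.
  apply: (@leq_trans T); first exact: ltnW.
  by rewrite mulnAC leq_pmull // muln_gt0 addn_gt0 lgb ltnW.
have cut : cutoff p T <= 4 * ((lg b + lg T) * lg T).
  apply: (@leq_trans ((2 * lg b) * (2 * lg T))).
    rewrite /cutoff -/b; apply: leq_mul; first by lia.
    by apply: leq_ltn_trans (leq_trunc_log _ (geq_minl _ _)) _; lia.
  by rewrite mulnACA leq_mul2l leq_mul2r leq_addr !orbT.
have Lu : (lg (2 * sigma * T * b) + lg T + 1) * ulg T
    <= (4 * sigma + 10) * ((lg b + lg T) * lg T).
  apply: (@leq_trans ((2 * sigma + 5) * (lg b + lg T) * (2 * lg T))).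
    apply: leq_mul; last by apply: leq_trans (ulg_leq_lg T) _; lia.
    have := lgM (2 * sigma * T) b; have := lgM (2 * sigma) T; have := lg_leq (2 * sigma).
    move: (lg _) (lg _) (lg (_ * T * b)) => x y z hx hy hz.
    by move: lgb lgT; move: (lg b) (lg T) hx hy hz => u v; nia.
  by apply: eq_leq; ring.
apply: (@leq_trans (Y + (X + Y) + b * T * ((4 * sigma + 14) * ((lg b + lg T) * lg T)))).
  rewrite mulnDr leq_add ?leq_add2l // leq_mul2l; apply/orP; right.
  by apply: leq_trans (leq_add cut Lu) _; apply: eq_leq; ring.
by rewrite mulnCA -/X; clear; move: X Y => x y; nia.
Qed.

(** The threshold 9 is sharp: 4 * 100 <= 512, whereas 4 * 81 > 256. *)
Lemma sqr_le_exp2 q : 9 <= q -> 4 * (q.+1 * q.+1) <= 2 ^ q.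
Proof.
elim: q => // q IH; rewrite leq_eqVlt => /predU1P[<- //|q9].
by rewrite expnS; have := IH q9; nia.
Qed.

Lemma stencilFFT_A_work_ge T : 0 < T ->
  b * T * (((lg b).+1 + (lg T).+1) * (lg T).+1) <= 648 * cost_work (stencilFFT_A p T).
Proof.
move=> T0; have [_ Hcut _ _] := stencilFFT_A_lower sigma_gt0 num_cells_gt1 T0.
set W := cost_work _ in Hcut *.
(* If T <= b, the minimum in the cut-off is T, and the direct steps alone give the product of the
   two logarithms. *)
have [Tb|bT] := leqP T b.
  have lTb : lg T <= lg b by rewrite leq_trunc_log.
  apply: (@leq_trans (2 * b * T * cutoff p T)); last by apply: leq_trans Hcut _; rewrite leq_pmull.
  rewrite /cutoff (minn_idPl Tb) -/b.
  apply: (@leq_trans (b * T * ((2 * (lg b).+1) * (lg T).+1))); last by apply: eq_leq; ring.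
  by rewrite leq_mul2l leq_mul2r; apply/orP; right; apply/orP; right; lia.
have lbT : lg b <= lg T by rewrite leq_trunc_log // ltnW.
have H2 : b * T * (((lg b).+1 + (lg T).+1) * (lg T).+1) <= 2 * b * T * ((lg T).+1 * (lg T).+1).
  apply: (@leq_trans (b * T * ((2 * (lg T).+1) * (lg T).+1))); last by apply: eq_leq; ring.
  by rewrite leq_mul2l leq_mul2r; apply/orP; right; apply/orP; right; lia.
apply: leq_trans H2 _.
(* Below 18 the squared logarithm is at most 18^2 = 324, a constant; from 18 on, q >= 9 as
   [sqr_le_exp2] requires. *)
have [l18|l18] := ltnP (lg T) 18.
  apply: (@leq_trans (2 * b * T * 324)).
    by rewrite leq_mul2l; apply/orP; right; apply: (@leq_mul _ _ 18 18).
  have Hc : 2 * b * T <= W.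
    by apply: leq_trans Hcut; rewrite leq_pmulr // (leq_trans _ (cutoff_ge p T)).
  by move: (2 * b * T) Hc => x; lia.
(* The threshold m = 2^q is about the square root of T: it is above the cut-off, which is O((log
   T)^2) here, and it leaves about q levels, each contributing a factor q. *)
pose q := (lg T)./2.
have lq : lg T <= 2 * q + 1 by rewrite /q; lia.
have q9 : 9 <= q by rewrite /q; lia.
have cm : cutoff p T <= 2 ^ q <= T.
  apply/andP; split; last first.
    by apply: leq_trans (trunc_logP (ltnSn 1) T0); rewrite leq_exp2l // /q; lia.
  apply: leq_trans (sqr_le_exp2 q9).
  have -> : 4 * (q.+1 * q.+1) = (2 * q.+1) * (2 * q.+1) by ring.
  rewrite /cutoff -/b; apply: leq_mul; first by lia.
  by apply: leq_ltn_trans (leq_trunc_log _ (geq_minl _ _)) _; lia.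
have := stencilFFT_A_work_levels sigma_gt0 num_cells_gt1 T0 cm.
rewrite -/b -/W trunc_expnK // => HW.
apply: (@leq_trans (648 * (2 * b * T * q * (lg T - q - 1)))); last by rewrite leq_mul2l HW orbT.
rewrite -[_ * q * _]mulnA [648 * _]mulnCA leq_mul2l; apply/orP; right.
apply: (@leq_trans ((2 * q + 2) * (2 * q + 2))); first by apply: leq_mul; lia.
apply: (@leq_trans (648 * (q * (q - 1)))); first by case: q q9 {lq cm HW} => // q q9; rewrite subn1 /=; nia.
by rewrite !leq_mul2l; apply/orP; right; apply/orP; right; rewrite /q; lia.
Qed.

End WorkInLogs.

Local Open Scope ring_scope.

(** * Comparison of the integer and real binary logarithms *)

Section Log2.

Variable R : realType.

Lemma ln2_gt0 : 0 < ln 2%:R :> R.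
Proof. by apply: ln_gt0; rewrite ltr1n. Qed.

Lemma log2_exp n : log2 (2 ^ n)%:R = n%:R :> R.
Proof.
by rewrite /log2 natrX lnXn ?ltr0n // -[_ *+ n]mulr_natl mulfK // gt_eqF // ln2_gt0.
Qed.

Lemma log2_le (x y : R) : 0 < x -> x <= y -> log2 x <= log2 y.
Proof.
move=> x0 xy; rewrite ler_pM2r ?invr_gt0 ?ln2_gt0 // ler_ln // posrE //.
exact: lt_le_trans xy.
Qed.

Lemma log2M (x y : R) : 0 < x -> 0 < y -> log2 (x * y) = log2 x + log2 y.
Proof. by move=> x0 y0; rewrite /log2 lnM ?posrE // mulrDl. Qed.

Lemma lg_le_log2 n : (0 < n)%N -> (lg n)%:R <= log2 n%:R :> R.
Proof.
by move=> n0; rewrite -[leLHS]log2_exp log2_le ?ltr0n ?expn_gt0 // ler_nat trunc_logP.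
Qed.

Lemma log2_le_ulg n : (0 < n)%N -> log2 n%:R <= (ulg n)%:R :> R.
Proof. by move=> n0; rewrite -[leRHS]log2_exp log2_le ?ltr0n // ler_nat up_logP. Qed.

Lemma log2_le_lgS n : (0 < n)%N -> log2 n%:R <= (lg n).+1%:R :> R.
Proof.
move=> n0; apply: le_trans (log2_le_ulg n0) _; rewrite ler_nat; exact: ulg_leq_lg.
Qed.

End Log2.

Theorem theorem2 (R : realType) (d sigma : nat) :
  (0 < d)%N -> (0 < sigma)%N ->
  (forall (C : numClosedFieldType) (p : stencil_problem C d sigma) (T : nat)
      (x : vec d),
    inner p 0 x -> output (stencilFFT_A p T) x = evolution p T x)
  /\
  (exists c1 c2 : R, [/\ 0 < c1, 0 < c2 &
    forall (C : numClosedFieldType) (p : stencil_problem C d sigma) (T : nat),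
      (1 < num_cells p)%N -> (0 < T)%N ->
      let N : R := (num_cells p)%:R in
      let b : R := (num_boundary_cells p)%:R in
      let t : R := T%:R in
      let W := b * t * log2 (b * t) * log2 t + N * log2 N in
      c1 * W <= (cost_work (stencilFFT_A p T))%:R <= c2 * W])
  /\
  (exists c1 c2 : R, [/\ 0 < c1, 0 < c2 &
    forall (C : numClosedFieldType) (p : stencil_problem C d sigma) (T : nat),
      (1 < num_cells p)%N -> (0 < T)%N ->
      let N : R := (num_cells p)%:R in
      let b : R := (num_boundary_cells p)%:R in
      let S := T%:R * log2 b + log2 N * log2 (log2 N) in
      c1 * S <= (cost_span (stencilFFT_A p T))%:R <= c2 * S]).
Proof.
move=> d0 s0; split; first by move=> C p T x; exact: output_stencilFFT_A.
split.
  pose cu := (alg_work_const d sigma * (4 * sigma + 16))%N.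
  (* 648 bounds the boundary term against the work and d bounds the term N log N; the two bounds are
     added. *)
  exists (648 + d)%:R^-1, cu%:R; split.
  - by rewrite invr_gt0 ltr0n.
  - by rewrite ltr0n muln_gt0 /alg_work_const !addn_gt0 !orbT.
  move=> C p T N1 T0; lazy zeta.
  set w := cost_work _; set N := num_cells p; set b := num_boundary_cells p.
  have b1 : (1 < b)%N := boundary_gt1 s0 N1.
  have b0 : (0 < b)%N := ltnW b1.
  have N0 : (0 < N)%N := ltnW N1.
  rewrite log2M ?ltr0n //.
  have lb1 : (lg b)%:R <= log2 b%:R :> R := lg_le_log2 R b0.
  have lb2 : log2 b%:R <= (lg b).+1%:R :> R := log2_le_lgS R b0.
  have lT1 : (lg T)%:R <= log2 T%:R :> R := lg_le_log2 R T0.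
  have lT2 : log2 T%:R <= (lg T).+1%:R :> R := log2_le_lgS R T0.
  have lN1 : (lg N)%:R <= log2 N%:R :> R := lg_le_log2 R N0.
  have lN2 : log2 N%:R <= (ulg N)%:R :> R := log2_le_ulg R N0.
  have lT0 : 0 <= log2 T%:R :> R by apply: le_trans lT1.
  have lb0 : 0 <= log2 b%:R :> R by apply: le_trans lb1.
  apply/andP; split.
    rewrite [leLHS]mulrC ler_pdivrMr ?ltr0n // [leRHS]mulrC natrD mulrDl; apply: lerD.
      rewrite -[leRHS]natrM; apply: (@le_trans _ _
        (b * T * (((lg b).+1 + (lg T).+1) * (lg T).+1))%N%:R).
        rewrite -[leLHS]mulrA !natrM natrD.
        by rewrite ler_wpM2l ?mulr_ge0 // ler_pM ?addr_ge0 ?lerD.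
      by rewrite ler_nat; exact: stencilFFT_A_work_ge.
    have [HN _ _ _] := stencilFFT_A_lower s0 N1 T0.
    rewrite -[leRHS]natrM; apply: (@le_trans _ _ (ulg N * N)%N%:R); last by rewrite ler_nat.
    by rewrite natrM mulrC ler_wpM2r.
  have := stencilFFT_A_work_le s0 N1 T0; rewrite -(ler_nat R) => H.
  apply: le_trans H _; rewrite natrM -/cu ler_wpM2l //.
  rewrite natrD !natrM natrD; apply: lerD; last by rewrite ler_wpM2l.
  by rewrite -[leRHS]mulrA ler_wpM2l ?mulr_ge0 // ler_pM ?addr_ge0 ?lerD.
(* With y = T log b >= 1 and z = log N log log N, the integer bound is at most 2y + 3z + 4, hence at
   most 6 (y + z). *)
pose cu := (alg_span_const d sigma * 6)%N.
(* The 1 is for T log b. With l the largest padded logarithm, the other term is at most d * l * (d +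
   lg l + 1), hence at most d * (d + 2) times the span. *)
exists (1 + d * (d + 2))%:R^-1, cu%:R; split.
- by rewrite invr_gt0 ltr0n.
- by rewrite ltr0n muln_gt0 andbT /alg_span_const -addnA addn_gt0.
move=> C p T N1 T0; lazy zeta.
set w := cost_span _; set N := num_cells p; set b := num_boundary_cells p.
have b1 : (1 < b)%N := boundary_gt1 s0 N1.
have b0 : (0 < b)%N := ltnW b1.
have N0 : (0 < N)%N := ltnW N1.
have lgN : (0 < lg N)%N by rewrite trunc_log_gt0.
have lgb : (0 < lg b)%N by rewrite trunc_log_gt0.
have lb1 : (lg b)%:R <= log2 b%:R :> R := lg_le_log2 R b0.
have lb2 : log2 b%:R <= (ulg b)%:R :> R := log2_le_ulg R b0.
have lN1 : (lg N)%:R <= log2 N%:R :> R := lg_le_log2 R N0.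
have lN2 : log2 N%:R <= (ulg N)%:R :> R := log2_le_ulg R N0.
have n1 : 1 <= log2 N%:R :> R by apply: le_trans lN1; rewrite ler1n.
have n0 : 0 < log2 N%:R :> R by apply: lt_le_trans n1.
have B1 : 1 <= log2 b%:R :> R by apply: le_trans lb1; rewrite ler1n.
have log2_1 : log2 1 = 0 :> R by rewrite /log2 ln1 mul0r.
have ll0 : 0 <= log2 (log2 N%:R) :> R by rewrite -log2_1 log2_le.
have T1 : 1 <= T%:R :> R by rewrite ler1n.
apply/andP; split.
  rewrite [leLHS]mulrC ler_pdivrMr ?ltr0n // [leRHS]mulrC natrD mulrDl mul1r.
  have [_ _ HT [l [Nl lw llw]]] := stencilFFT_A_lower s0 N1 T0.
  rewrite -/w -/N -/b in HT Nl lw llw; clearbody w.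
  apply: lerD.
    apply: (@le_trans _ _ (T * ulg b)%N%:R); last by rewrite ler_nat.
    by rewrite natrM ler_wpM2l.
  rewrite -[leRHS]natrM; apply: (@le_trans _ _ ((d * l) * (d + lg l + 1))%N%:R).
    rewrite natrM ler_pM ?(ltW n0) //.
      by apply: le_trans lN2 _; rewrite ler_nat.
    apply: le_trans (log2_le n0 lN2) _.
    have uN0 : (0 < ulg N)%N by rewrite up_log_gt0.
    apply: le_trans (log2_le_ulg R uN0) _; rewrite ler_nat.
    apply: leq_trans (leq_up_log 2 Nl) _; apply: leq_trans (ulgM d l) _.
    rewrite -addnA leq_add //; first exact: leq_trans (ulg_leq_pred d) (leq_pred d).
    by rewrite addn1 ulg_leq_lg.
  rewrite ler_nat -!mulnA leq_mul2l; apply/orP; right.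
  apply: (@leq_trans (d * w + w + w)); last by apply: eq_leq; ring.
  by rewrite !mulnDr muln1 !leq_add // mulnC leq_mul2l lw orbT.
have [_ H] := ub_stencilFFT_A s0 N1 T0.
move: H; rewrite -(ler_nat R) => H; apply: le_trans H _.
rewrite natrM natrM -mulrA ler_wpM2l //.
rewrite natrD !natrM -/b -/N.
have H1 : (lg b).+1%:R <= 2 * log2 b%:R :> R by rewrite -natr1; lra.
have H2 : (ulg (lg N)).+1%:R <= log2 (log2 N%:R) + 2 :> R.
  have : (ulg (lg N))%:R <= (lg (lg N)).+1%:R :> R by rewrite ler_nat ulg_leq_lg.
  have : (lg (lg N))%:R <= log2 (lg N)%:R :> R by exact: lg_le_log2.
  have : log2 (lg N)%:R <= log2 (log2 N%:R) :> R by rewrite log2_le // ltr0n.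
  by rewrite -!natr1; lra.
(* For N < 4 the factor log log N may be as small as 0; the added 2 covers this case and is later
   absorbed by T log b >= 1. *)
have H3 : log2 N%:R <= log2 N%:R * log2 (log2 N%:R) + 2 :> R.
  have [N4|N4] := leqP 4 N; last first.
    have : log2 N%:R <= log2 (2 ^ 2)%:R :> R by rewrite log2_le ?ltr0n // ler_nat ltnW.
    by rewrite log2_exp; have := mulr_ge0 (ltW n0) ll0; lra.
  have n2 : 2 <= log2 N%:R :> R by rewrite -[leLHS](log2_exp R 2) log2_le ?ltr0n // ler_nat.
  have l1 : 1 <= log2 (log2 N%:R) :> R by rewrite -[leLHS](log2_exp R 1) log2_le ?ltr0n.
  by have := ler_wpM2l (ltW n0) l1; lra.
have H4 : (lg N)%:R * (ulg (lg N)).+1%:R <= log2 N%:R * (log2 (log2 N%:R) + 2) :> R.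
  by rewrite ler_pM.
have H5 : (lg b).+1%:R * T%:R <= 2 * (T%:R * log2 b%:R) :> R.
  by rewrite mulrCA mulrC ler_wpM2l.
have H6 : 1 <= T%:R * log2 b%:R :> R by rewrite mulr_ege1.
have := mulr_ge0 (ltW n0) ll0; rewrite mulrDr in H4.
move: H3 H4 H5 H6.
set u := _ * T%:R; set v := (lg N)%:R * _; set y := T%:R * log2 _; set z := log2 N%:R * log2 _.
by clear; clearbody u v y z; move: (log2 N%:R) => n *; lra.
Qed.
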